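(* For every $p>0$ with $p\neq 2$ there is full $p$-concentration with gap at $0$: for every $c<1$, every symmetric open set $E\subset\mathbb{T}$ containing $0$ and every $N>0$ there is $f\in\mathcal{P}$ with gaps larger than $N$ such that $\int_E|f|^p\ge c\int_{\mathbb{T}}|f|^p$. For $p=2$, positive concentration with arbitrarily large gaps is possible at no point of $\mathbb{T}$: for every $a\in\mathbb{T}$ there is no constant $c>0$ such that for every symmetric open set $E\subset\mathbb{T}$ containing $a$ and every $N>0$ there is $f\in\mathcal{P}$ with gaps larger than $N$ such that $\int_E|f|^2\ge c\int_{\mathbb{T}}|f|^2$.
   Context: $\mathbb{T}=\mathbb{R}/\mathbb{Z}$ with Lebesgue measure of total mass $1$; $e(t)=e^{2\pi i t}$; $\mathbb{N}$ denotes the nonnegative integers. $\mathcal{P}$ is the set of idempotents, i.e. of functions $f(x)=\sum_{h\in H}e(hx)$ on $\mathbb{T}$ with $H\subset\mathbb{N}$ finite and nonempty. Such an $f$ has gaps larger than $N$ if consecutive elements of $H$ (in increasing order) differ by more than $N$. A set $E\subset\mathbb{T}$ is symmetric if $x\in E$ implies $-x\in E$. *)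

(* Defs.v *)
From HB Require Import structures.
From mathcomp Require Import all_boot all_order all_algebra finmap.
From mathcomp Require Import all_classical all_reals all_analysis.
From mathcomp Require Import complex.

Set Implicit Arguments.
Unset Strict Implicit.
Unset Printing Implicit Defensive.

Import Order.TTheory GRing.Theory Num.Theory.
Import numFieldNormedType.Exports.

Local Open Scope classical_set_scope.
Local Open Scope ring_scope.

(* The circle R/Z is handled through the projection R -> R/Z: functions on it
   are 1-periodic functions on R, and its subsets are the 1-periodic subsets of
   R.  A subset of R/Z is open (resp. symmetric) iff its preimage in R is. *)

Definition periodic_set (R : realType) (E : set R) : Prop :=
  forall x : R, E (x + 1) <-> E x.

Definition symmetric_set (R : realType) (E : set R) : Prop :=
  forall x : R, E x -> E (- x).

Definition expi (R : realType) (t : R) : R[i] :=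
  Complex (cos (2 * pi * t)) (sin (2 * pi * t)).

Definition exp_sum (R : realType) (H : {fset nat}) : R -> R[i] :=
  fun x => \sum_(h <- H) expi (h%:R * x).

Definition gaps_larger (N : nat) (H : {fset nat}) : Prop :=
  forall h k : nat, h \in H -> k \in H -> (h < k)%N ->
    (forall l : nat, l \in H -> ~~ (h < l < k)%N) ->
    (N < k - h)%N.

(* Distinct sets H give distinct functions f, so having gaps larger than N is a
   property of f. *)
Definition idempotent_gaps (R : realType) (N : nat) (f : R -> R[i]) : Prop :=
  exists H : {fset nat},
    [/\ H != fset0, gaps_larger N H & f = exp_sum H].

(* The integral over E in R/Z is computed on the fundamental domain [0, 1[. *)
Definition circle_integral (R : realType) (p : R) (E : set R)
    (f : R -> R[i]) : \bar R :=
  (\int[lebesgue_measure]_(x in E `&` `[0%R, 1%R[)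
     ((ComplexField.Normc.normc (f x)) `^ p)%:E)%E.

Definition concentrates_with_gaps (R : realType) (p a c : R) : Prop :=
  forall E : set R, periodic_set E -> symmetric_set E -> open E -> E a ->
  forall N : nat, (0 < N)%N ->
  exists f : R -> R[i], idempotent_gaps N f /\
    (c%:E * circle_integral p setT f <= circle_integral p E f)%E.

(* Main.v *)
(* For p <> 2 and real theta let Phi(theta) be the integral over y in T of
   |1 + e(y) + e(2y + theta)|^p.  Completing the square shows that Phi depends
   only on |cos(pi theta)|, and convexity (p > 2) or concavity (p < 2) of
   t |-> t^(p/2) makes it strictly monotone: Phi has a unique maximum theta_0 on
   T, namely 0 if p > 2 and 1/2 if p < 2.

   If f(x) is the product of 1 + e(M_i x) + e((2 M_i + K_i) x) with M_i
   increasing fast enough, then f is an idempotent with large gaps, and the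
   M_i x equidistribute independently of x, so that the integral of w |f|^p is
   close to that of w times the product of the Phi(K_i x).  Taking K and K + 1,
   each repeated n times, this product is Psi^n with
   Psi(x) = Phi(K x) Phi((K + 1) x).  For x away from 0 the points K x and
   (K + 1) x are not both near theta_0, so Psi(x) is bounded away from
   Phi(theta_0)^2, whereas Psi(theta_0 / K) is close to that value for K large.
   As n grows, Psi^n concentrates near 0.

   For p = 2 the gaps make |f|^2 orthogonal to all nonconstant frequencies at
   most L, so testing against the translates to a and -a of |D_L|^2 / L^2, with
   D_L the Dirichlet kernel, bounds the mass of |f|^2 near a and -a by 4 / L. *)
Require Import Defs.
From mathcomp Require Import all_boot all_order all_algebra finmap ring lra zify.
From mathcomp Require Import all_classical all_reals all_analysis.
From mathcomp Require Import complex.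
Set Implicit Arguments.
Unset Strict Implicit.
Unset Printing Implicit Defensive.
Import Order.TTheory GRing.Theory Num.Theory.
Import numFieldNormedType.Exports.
Local Open Scope classical_set_scope.
Local Open Scope ring_scope.

(** * Powers and bounded uniformly continuous functions *)

Section Power.
Context {R : realType}.
Implicit Types a b l m s t x : R.

(* Without the absolute value continuity fails at 0, since x `^ s = 1 for x < 0. *)
Lemma continuous_norm_powR s : 0 < s -> continuous (fun x => `|x| `^ s).
Proof.
move=> s0 x; have [->|x0] := eqVneq x 0.
  rewrite /continuous_at normr0 powR0 ?gt_eqF//; apply/cvgr0Pnorm_lt => e e0.
  near=> y; rewrite ger0_norm ?powR_ge0//.
  have -> : e = (e `^ s^-1) `^ s by rewrite -powRrM mulVf ?gt_eqF// powRr1// ltW.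
  apply: gt0_ltr_powR; rewrite ?nnegrE ?powR_ge0//.
  near: y; apply: (@nbhs0_lt _ R^o); exact: powR_gt0.
have nx : 0 < `|x| by rewrite normr_gt0.
apply: (@continuous_comp _ _ _ (fun x : R => `|x|) (fun y => y `^ s)).
  exact: norm_continuous.
apply: differentiable_continuous; apply/derivable1_diffP.
by apply: derivable_powR; rewrite in_itv/= andbT.
Unshelve. all: by end_near. Qed.

Let g s a t : R := `|a + t| `^ s + `|a - t| `^ s.

Let g_continuous s a : 0 < s -> continuous (g s a).
Proof.
move=> s0 t; apply: (@cvgD _ R^o).
  apply: (@continuous_comp _ _ _ (fun t : R => a + t) (fun x => `|x| `^ s)).
    by apply: (@cvgD _ R^o); [exact: cvg_cst|exact: cvg_id].
  exact: continuous_norm_powR.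
apply: (@continuous_comp _ _ _ (fun t : R => a - t) (fun x => `|x| `^ s)).
  by apply: (@cvgB _ R^o); [exact: cvg_cst|exact: cvg_id].
exact: continuous_norm_powR.
Qed.

Let g_derive s a t : 0 < t < a ->
  is_derive t 1 (g s a) (s * (a + t) `^ (s - 1) - s * (a - t) `^ (s - 1)).
Proof.
move=> /andP[t0 ta].
have h1 : is_derive t 1 (fun t : R => (a + t) `^ s) (s * (a + t) `^ (s - 1)).
  have d1 : is_derive t 1 (fun t : R => a + t) 1.
    by have := is_deriveD (is_derive_cst a t 1) (is_derive_id t (1 : R)); rewrite add0r.
  have d2 : is_derive (a + t) 1 (fun x : R => x `^ s) (s * (a + t) `^ (s - 1)).
    by apply: is_derive1_powR; lra.
  by have := is_derive1_comp d2 d1; rewrite mulr1.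
have h2 : is_derive t 1 (fun t : R => (a - t) `^ s) (- (s * (a - t) `^ (s - 1))).
  have d1 : is_derive t 1 (fun t : R => a - t) (-1).
    by have := is_deriveB (is_derive_cst a t 1) (is_derive_id t (1 : R)); rewrite sub0r.
  have d2 : is_derive (a - t) 1 (fun x : R => x `^ s) (s * (a - t) `^ (s - 1)).
    by apply: is_derive1_powR; lra.
  have := @is_derive1_comp _ (fun x : R => x `^ s) (fun t : R => a - t) t _ _ d2 d1.
  by rewrite mulrN1.
have h : is_derive t 1 (fun t : R => (a + t) `^ s + (a - t) `^ s)
   (s * (a + t) `^ (s - 1) - s * (a - t) `^ (s - 1)) := is_deriveD h1 h2.
apply: near_eq_is_derive h.
near=> u.
have : `|t - u| < Num.min t (a - t).
  near: u; apply: cvgr_dist_lt; last by rewrite lt_min; apply/andP; split; lra.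
  exact: cvg_id.
rewrite lt_min => /andP[/ltr_normlP[? ?] /ltr_normlP[? ?]].
rewrite /g !ger0_norm//; lra.
Unshelve. all: by end_near. Qed.

Let itv_cont s a : 0 < s -> {within `[0, a], continuous (g s a)}.
Proof. by move=> s0; apply: continuous_subspaceT; exact: g_continuous. Qed.

(** On ]0, a[ the derivative in t of (a + t)^s + (a - t)^s is s ((a + t)^(s-1) - (a - t)^(s-1)),
    which has the sign of s - 1; continuity on [0, a] brings in the endpoints. *)
Lemma powR_sym_sum_lt_convex s a l m : 1 < s -> 0 <= l -> l < m -> m <= a ->
  `|a + l| `^ s + `|a - l| `^ s < `|a + m| `^ s + `|a - m| `^ s.
Proof.
move=> s1 l0 lm ma.
apply: (@gtr0_derive1_lt_cc _ (g s a) 0 a) => //.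
- by move=> t; rewrite in_itv/= => ta; have [] := g_derive s ta.
- move=> t; rewrite in_itv/= => ta; have [_ D] := g_derive s ta.
  rewrite derive1E D subr_gt0 ltr_pM2l; last lra.
  move: ta => /andP[t0 ta].
  by apply: gt0_ltr_powR; rewrite ?nnegrE; lra.
- apply: itv_cont; lra.
- by rewrite in_itv/=; apply/andP; split; lra.
- by rewrite in_itv/=; apply/andP; split; lra.
Qed.

Lemma powR_sym_sum_lt_concave s a l m : 0 < s < 1 -> 0 <= l -> l < m -> m <= a ->
  `|a + m| `^ s + `|a - m| `^ s < `|a + l| `^ s + `|a - l| `^ s.
Proof.
move=> /andP[s0 s1] l0 lm ma.
apply: (@ltr0_derive1_lt_cc _ (g s a) 0 a) => //.
- by move=> t; rewrite in_itv/= => ta; have [] := g_derive s ta.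
- move=> t; rewrite in_itv/= => ta; have [_ D] := g_derive s ta.
  rewrite derive1E D subr_lt0 ltr_pM2l//.
  move: ta => /andP[t0 ta].
  rewrite -(opprB 1 s) !powRN ltf_pV2 ?posrE; try (by apply: powR_gt0; lra).
  by apply: gt0_ltr_powR; rewrite ?nnegrE; lra.
- exact: itv_cont.
- by rewrite in_itv/=; apply/andP; split; lra.
- by rewrite in_itv/=; apply/andP; split; lra.
Qed.

End Power.

Section BoundedUniformlyContinuous.
Context {R : realType}.
Implicit Types (h k : R -> R -> R) (f g : R -> R) (a b c d e x y : R).

Lemma fun_continuousD f g : continuous f -> continuous g ->
  continuous (fun x => f x + g x).
Proof. by move=> cf cg x; exact: (cvgD (cf x) (cg x)). Qed.

Lemma fun_continuousB f g : continuous f -> continuous g ->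
  continuous (fun x => f x - g x).
Proof. by move=> cf cg x; exact: (cvgB (cf x) (cg x)). Qed.

Lemma fun_continuousM f g : continuous f -> continuous g ->
  continuous (fun x => f x * g x).
Proof. by move=> cf cg x; exact: (cvgM (cf x) (cg x)). Qed.

Lemma fun_continuous_cst c : continuous (fun _ : R => c).
Proof. by move=> x; exact: cvg_cst. Qed.

Lemma eq_fun_continuous f g : f =1 g -> continuous f -> continuous g.
Proof. by move=> fg; rewrite (_ : f = g)//; exact/funext. Qed.

(** Only x is confined to [-B, B]; y may leave the segment. Each point has a ball on which f stays
    within e / 2 of its central value, and compactness makes the radius uniform. *)
Lemma heine_segment f B e : continuous f -> 0 < e ->
  exists2 d : R, 0 < d & forall x y, `|x| <= B -> `|x - y| <= d ->
    `|f x - f y| <= e.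
Proof.
move=> cf e0.
have /compact_near_coveringP : compact `[-B, B] by exact: segment_compact.
move=> /(_ _ (0 : R)^'+ (fun d x => forall y, `|x - y| <= d -> `|f x - f y| <= e)).
have nc x : \forall z \near x, `|f x - f z| < e / 2.
  by have /cvgrPdist_lt := cf x; apply; lra.
case=> [x _|d /= d0 H].
- have /nbhs_ballP[r /= r0 xr] := nc x.
  exists (ball x (r / 2), [set d | d < r / 2]).
    split=> /=; first by apply/nbhs_ballP; exists (r / 2) => //=; lra.
    by apply: nbhs_right_lt; lra.
  move=> [z d]/= [xz dr] y zy.
  have xz' : `|f x - f z| < e / 2.
    by apply: xr; move: xz; rewrite /ball/= => xz; lra.
  have xy' : `|f x - f y| < e / 2.
    apply: xr; move: xz; rewrite /ball/= => xz.
    have := ler_normD (x - z) (z - y); rewrite subrKA; lra.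
  rewrite (_ : f z - f y = (f x - f y) - (f x - f z)); last ring.
  by rewrite (le_trans (ler_normB _ _))//; lra.
exists (d / 2); first by move: d0 => /=; lra.
move=> x y xB xy; apply: (H (d / 2)) => //=.
- by rewrite /ball_/= sub0r normrN gtr0_norm; move: d0 => /=; lra.
- by move: d0 => /=; lra.
- by rewrite in_itv/= -ler_norml.
Qed.

(** The class of integrands to which the equidistribution argument applies. Boundedness makes it
    stable under products and under composition with continuous functions. A function of one
    variable enters as a kernel constant in y. *)
Definition buc h := (exists B, forall x y, `|h x y| <= B) /\
  forall e, 0 < e -> exists2 d : R, 0 < d & forall x x' y y',
    `|x - x'| <= d -> `|y - y'| <= d -> `|h x y - h x' y'| <= e.

Lemma eq_buc h k : (forall x y, h x y = k x y) -> buc h -> buc k.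
Proof. by move=> hk; rewrite (_ : h = k)//; apply/funext => x; apply/funext => y. Qed.

Lemma buc_cst c : buc (fun _ _ => c).
Proof.
split; first by exists `|c|.
by move=> e e0; exists 1 => // *; rewrite subrr normr0 ltW.
Qed.

Lemma bucD h k : buc h -> buc k -> buc (fun x y => h x y + k x y).
Proof.
move=> [[B hB] uh] [[C kC] uk]; split.
  by exists (B + C) => x y; rewrite (le_trans (ler_normD _ _))// lerD.
move=> e e0; have e20 : 0 < e / 2 by lra.
have [d d0 hd] := uh _ e20; have [d' d'0 kd] := uk _ e20.
exists (Num.min d d'); first by rewrite lt_min d0.
move=> x x' y y'; rewrite !le_min => /andP[x1 x2] /andP[y1 y2].
rewrite opprD addrACA (le_trans (ler_normD _ _))//.
by have := hd _ _ _ _ x1 y1; have := kd _ _ _ _ x2 y2; lra.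
Qed.

Lemma bucM h k : buc h -> buc k -> buc (fun x y => h x y * k x y).
Proof.
move=> [[B hB] uh] [[C kC] uk].
have B0 : 0 <= B by exact: le_trans (hB 0 0).
have C0 : 0 <= C by exact: le_trans (kC 0 0).
split.
  by exists (B * C) => x y; rewrite normrM ler_pM.
move=> e e0; have ee : 0 < e / (B + C + 1) by rewrite divr_gt0//; lra.
have [d d0 hd] := uh _ ee; have [d' d'0 kd] := uk _ ee.
exists (Num.min d d'); first by rewrite lt_min d0.
move=> x x' y y'; rewrite !le_min => /andP[x1 x2] /andP[y1 y2].
rewrite (_ : _ - _ = h x y * (k x y - k x' y') + (h x y - h x' y') * k x' y');
  last ring.
rewrite (le_trans (ler_normD _ _))// !normrM.
have := ler_pM (normr_ge0 _) (normr_ge0 _) (hB x y) (kd _ _ _ _ x2 y2).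
have := ler_pM (normr_ge0 _) (normr_ge0 _) (hd _ _ _ _ x1 y1) (kC x' y').
have : e / (B + C + 1) * C + B * (e / (B + C + 1)) <= e.
  by rewrite [B * _]mulrC -mulrDr mulrAC ler_pdivrMr ?ler_wpM2l//; lra.
lra.
Qed.

Lemma buc_comp f h : continuous f -> buc h -> buc (fun x y => f (h x y)).
Proof.
move=> cf [[B hB] uh].
have B0 : 0 <= B by exact: le_trans (hB 0 0).
split.
  have [M [_ HM]] : bounded_set (f @` `[-B, B]).
    apply: compact_bounded; apply: continuous_compact; last exact: segment_compact.
    exact: continuous_subspaceT.
  exists (M + 1) => x y; apply: (HM (M + 1)); first lra.
  by exists (h x y) => //=; rewrite in_itv/= -ler_norml.
move=> e e0; have [d d0 fd] := heine_segment B cf e0.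
have [d' d'0 hd] := uh _ d0.
exists d' => // x x' y y' xx yy; apply: fd => //; exact: hd.
Qed.

Lemma buc_affine h a b c a' b' c' :
  buc h -> buc (fun x y => h (a * x + b * y + c) (a' * x + b' * y + c')).
Proof.
move=> [[B hB] uh]; split; first by exists B => x y; exact: hB.
move=> e e0; have [d d0 hd] := uh _ e0.
set L := `|a| + `|b| + `|a'| + `|b'| + 1.
have L0 : 0 < L by rewrite ltr_wpDl// !addr_ge0.
exists (d / L); first exact: divr_gt0.
move=> x x' y y' xx yy.
have E (p q r : R) : `|p| + `|q| <= L ->
    `|(p * x + q * y + r) - (p * x' + q * y' + r)| <= d.
  move=> pq; rewrite (_ : _ - _ = p * (x - x') + q * (y - y')); last ring.
  rewrite (le_trans (ler_normD _ _))// !normrM.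
  apply: (@le_trans _ _ (`|p| * (d / L) + `|q| * (d / L))).
    by rewrite lerD// ler_wpM2l.
  by rewrite -mulrDl mulrA ler_pdivrMr// mulrC ler_pM2l.
have := (normr_ge0 a, normr_ge0 b, normr_ge0 a', normr_ge0 b').
move=> [[[]]] *; apply: hd; apply: E; rewrite /L; lra.
Qed.

(** The bound depends on x - y only, so continuity of cosine and sine at 0 gives uniform continuity
    of cosine on the whole line. *)
Lemma dist_cos_le x y : `|cos x - cos y| <= `|1 - cos (x - y)| + `|sin (x - y)|.
Proof.
have -> : cos x - cos y = (cos (x - y) - 1) * cos y - sin (x - y) * sin y.
  have := cosD (x - y) y; rewrite subrK => ->; ring.
rewrite (le_trans (ler_normB _ _))// !normrM distrC.
by rewrite lerD// ler_piMr// ?cos_max ?sin_max.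
Qed.

Lemma buc_cos : buc (fun x _ => cos x).
Proof.
split; first by exists 1 => x _; exact: cos_max.
move=> e e0; have e20 : 0 < e / 2 by lra.
have [d d0 hd] := heine_segment 0 (@continuous_cos R) e20.
have [d' d'0 hd'] := heine_segment 0 (@continuous_sin R) e20.
exists (Num.min d d'); first by rewrite lt_min d0.
move=> x x' y y'; rewrite le_min => /andP[x1 x2] _.
apply: le_trans (dist_cos_le _ _) _.
have := hd 0 (x - x'); rewrite normr0 sub0r normrN cos0 => /(_ (lexx _) x1).
have := hd' 0 (x - x'); rewrite normr0 !sub0r !normrN sin0 sub0r normrN.
by move=> /(_ (lexx _) x2); lra.
Qed.

Lemma buc_cos_affine a b c : buc (fun x y => cos (a * x + b * y + c)).
Proof. exact: buc_affine buc_cos. Qed.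

Lemma buc_continuous h y : buc h -> continuous (h ^~ y).
Proof.
move=> [_ uh] x; apply/cvgrPdist_le => e e0; have [d d0 hd] := uh _ e0.
near=> z; apply: hd; last by rewrite subrr normr0 ltW.
near: z; apply: cvgr_dist_le => //; exact: cvg_id.
Unshelve. all: by end_near. Qed.

Lemma buc_continuousr h x : buc h -> continuous (h x).
Proof.
move=> [_ uh] y; apply/cvgrPdist_le => e e0; have [d d0 hd] := uh _ e0.
near=> z; apply: hd; first by rewrite subrr normr0 ltW.
near: z; apply: cvgr_dist_le => //; exact: cvg_id.
Unshelve. all: by end_near. Qed.

End BoundedUniformlyContinuous.

(** * Means over the circle *)

Section Mean.
Context {R : realType}.
Implicit Types (f g : R -> R) (a b c s x : R).

Let mu := @lebesgue_measure R.

(** On the closed interval every continuous function is integrable by compactness; [meanE] passes to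
    the half-open fundamental domain. *)
Definition mean g : R := \int[lebesgue_measure]_(x in `[0%R, 1%R]) g x.

Lemma continuous_integrable_itv g a b :
  continuous g -> mu.-integrable `[a, b] (EFin \o g).
Proof.
move=> cg; apply: continuous_compact_integrable; first exact: segment_compact.
exact: continuous_subspaceT.
Qed.

Lemma mean_cst c : mean (fun=> c) = c.
Proof.
by rewrite /mean Rintegral_cst//= lebesgue_measure_itv/= lte01 sube0 mulr1.
Qed.

Lemma meanD f g : continuous f -> continuous g ->
  mean (fun x => f x + g x) = mean f + mean g.
Proof. by move=> cf cg; apply: RintegralD => //; exact: continuous_integrable_itv. Qed.

Lemma meanB f g : continuous f -> continuous g ->
  mean (fun x => f x - g x) = mean f - mean g.
Proof. by move=> cf cg; apply: RintegralB => //; exact: continuous_integrable_itv. Qed.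

Lemma meanZ c f : continuous f -> mean (fun x => c * f x) = c * mean f.
Proof. by move=> cf; apply: RintegralZl => //; exact: continuous_integrable_itv. Qed.

Lemma le_mean f g : continuous f -> continuous g ->
  (forall x, f x <= g x) -> mean f <= mean g.
Proof.
move=> cf cg fg; apply: le_Rintegral => //; exact: continuous_integrable_itv.
Qed.

Lemma continuous_sum (I : Type) (r : seq I) (F : I -> R -> R) :
  (forall i, continuous (F i)) -> continuous (fun x => \sum_(i <- r) F i x).
Proof.
move=> cF; elim: r => [|j r IHr] x.
  by under eq_fun do rewrite big_nil; exact: cvg_cst.
by under eq_fun do rewrite big_cons; exact: fun_continuousD.
Qed.

Lemma mean_sum (I : Type) (r : seq I) (F : I -> R -> R) :
  (forall i, continuous (F i)) ->
  mean (fun x => \sum_(i <- r) F i x) = \sum_(i <- r) mean (F i).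
Proof.
move=> cF; elim: r => [|i r IHr].
  by under eq_fun do rewrite big_nil; rewrite big_nil mean_cst.
under eq_fun do rewrite big_cons; rewrite big_cons meanD ?IHr//.
exact: continuous_sum.
Qed.

Lemma norm_mean_le f e : continuous f -> (forall x, `|f x| <= e) -> `|mean f| <= e.
Proof.
move=> cf fe; have cc := @fun_continuous_cst R.
rewrite ler_norml; apply/andP; split.
  rewrite -(mean_cst (- e)); apply: le_mean => // x.
  by have := fe x; rewrite ler_norml => /andP[].
rewrite -(mean_cst e); apply: le_mean => // x.
by have := fe x; rewrite ler_norml => /andP[].
Qed.

Lemma Rintegral_shift g a b s : a <= b -> continuous g ->
  \int[mu]_(x in `[(a + s)%R, (b + s)%R]) g x = \int[mu]_(x in `[a, b]) g (x + s).
Proof.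
move=> ab cg; congr fine.
have dE : (fun x : R => x + s)^`()%classic = cst 1.
  by apply/funext => x; rewrite derive1E deriveD// derive_id derive_cst addr0.
have cF : continuous (fun x : R => x + s).
  by move=> x; apply: (@cvgD _ R^o); [exact: cvg_id|exact: cvg_cst].
rewrite (@integration_by_substitution_increasing _ (fun x => x + s) g a b)//.
- by apply: eq_integral => x _; rewrite /= dE/= mulr1.
- by move=> x y _ _ xy; rewrite ltrD2r.
- by rewrite dE => x _; exact: cvg_cst.
- by rewrite dE; exact: is_cvg_cst.
- by rewrite dE; exact: is_cvg_cst.
- split.
  + by move=> x _; exact: derivableD.
  + exact/cvg_at_right_filter/cF.
  + exact/cvg_at_left_filter/cF.
- exact: continuous_subspaceT.
Qed.

Lemma periodic_int g (n : int) x :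
  (forall x, g (x + 1) = g x) -> g (x + n%:~R) = g x.
Proof.
move=> pg; have pn (m : nat) y : g (y + m%:R) = g y.
  by elim: m => [|m IHm]; rewrite ?addr0// -natr1 addrA pg.
case: (intP n) => [|m|m]; first by rewrite addr0.
- exact: pn.
- by rewrite -(pn m.+1) rmorphN/= subrK.
Qed.

(** Once s is reduced to [0, 1[ by periodicity, [0, 1] and [s, 1 + s] share [s, 1], and the
    remaining pieces [0, s] and [1, 1 + s] are translates of each other by 1. *)
Lemma mean_shift g s : continuous g -> (forall x, g (x + 1) = g x) ->
  mean (fun x => g (x + s)) = mean g.
Proof.
move=> cg pg.
wlog /andP[s0 s1] : s / 0 <= s < 1.
  move=> H; rewrite -[RHS](H (s - (Num.floor s)%:~R)).
    by congr mean; apply/funext => x; rewrite addrA -rmorphN/= periodic_int.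
  by have := floor_itv s; rewrite subr_ge0 ltrBlDl intrD => /andP[-> ->].
have ig a b := continuous_integrable_itv a b cg.
rewrite /mean -Rintegral_shift// add0r.
have := @Rintegral_itvB _ g (BLeft 0) (BRight 1) s (ig _ _).
have := @Rintegral_itvB _ g (BLeft s) (BRight (1 + s)) 1 (ig _ _).
rewrite !Rintegral_itv_obnd_cbnd; last 2 first.
- apply: integrableS (ig s 1) => //; exact: subset_itv_oc_cc.
- apply: integrableS (ig 1 (1 + s)) => //; exact: subset_itv_oc_cc.
rewrite !bnd_simp s0 (ltW s1) lerDl s0 => /(_ isT isT) A /(_ isT isT) B.
have : \int[mu]_(x in `[1%R, (1 + s)%R]) g x = \int[mu]_(x in `[0%R, s]) g x.
  have := @Rintegral_shift g 0 s 1 s0 cg; rewrite add0r (addrC s 1) => ->.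
  by under eq_Rintegral do rewrite pg.
by rewrite /mu in A B *; lra.
Qed.

End Mean.

(** * Circle integrals bounded by weighted means *)

Section CircleIntegral.
Context {R : realType}.
Implicit Types (g w : R -> R) (f : R -> R[i]) (E : set R) (p x : R).

Let mu := @lebesgue_measure R.

Lemma meanE g : continuous g ->
  (mean g)%:E = (\int[mu]_(x in `[0%R, 1%R[) (g x)%:E)%E.
Proof.
move=> cg; have ig := continuous_integrable_itv 0 1 cg.
rewrite integral_itv_bndo_bndc; last first.
  apply: measurable_funS (measurable_int _ ig) => //; exact: subset_itv_co_cc.
by rewrite /mean /Rintegral fineK// integrable_fin_num.
Qed.

Lemma circle_integralT p f g : continuous g ->
  (forall x, ComplexField.Normc.normc (f x) `^ p = g x) ->
  circle_integral p setT f = (mean g)%:E.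
Proof.
move=> cg fg; rewrite meanE// /circle_integral setTI.
by apply: eq_integral => x _; rewrite fg.
Qed.

Let integrable_itv E g : measurable (E : set (measurableTypeR R)) -> continuous g ->
  mu.-integrable (E `&` `[0%R, 1%R[) (EFin \o g).
Proof.
move=> mE cg; apply: integrableS (continuous_integrable_itv 0 1 cg) => //.
  exact: measurableI.
by move=> x [_]; exact: subset_itv_co_cc.
Qed.

(** On the fundamental domain w is a continuous minorant of the indicator of E. *)
Lemma circle_integral_ge p E f g w :
  measurable (E : set (measurableTypeR R)) -> continuous g -> continuous w ->
  (forall x, ComplexField.Normc.normc (f x) `^ p = g x) ->
  (forall x, 0 <= w x <= 1) -> (forall x, 0 <= x < 1 -> ~ E x -> w x = 0) ->
  ((mean (fun x => w x * g x))%:E <= circle_integral p E f)%E.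
Proof.
move=> mE cg cw fg w01 wE.
have g0 x : 0 <= g x by rewrite -fg powR_ge0.
have mEI : measurable (E `&` `[0%R, 1%R[ : set (measurableTypeR R)) by exact: measurableI.
have cwg : continuous (fun x => w x * g x) by exact: fun_continuousM.
rewrite meanE// /circle_integral.
have -> : (\int[mu]_(x in `[0%R, 1%R[) (w x * g x)%:E =
    \int[mu]_(x in E `&` `[0%R, 1%R[) (w x * g x)%:E)%E.
  rewrite integral_mkcondl; apply: eq_integral => x; rewrite inE/= in_itv/= => x01.
  rewrite patchE; case: ifPn => // /negP xE.
  by rewrite wE ?mul0r// => Ex; apply: xE; rewrite inE.
under [leRHS]eq_integral do rewrite fg.
apply: ge0_le_integral => //=.
- by move=> x _; rewrite lee_fin mulr_ge0//; have /andP[] := w01 x.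
- exact: measurable_int (integrable_itv mE cwg).
- exact: measurable_int (integrable_itv mE cg).
- by move=> x _; rewrite lee_fin ler_piMl//; have /andP[] := w01 x.
Qed.

(** Here w is a continuous majorant of the indicator of E. *)
Lemma circle_integral_le p E f g w :
  measurable (E : set (measurableTypeR R)) -> continuous g -> continuous w ->
  (forall x, ComplexField.Normc.normc (f x) `^ p = g x) ->
  (forall x, 0 <= w x) -> (forall x, E x -> 1 <= w x) ->
  (circle_integral p E f <= (mean (fun x => w x * g x))%:E)%E.
Proof.
move=> mE cg cw fg w0 wE.
have g0 x : 0 <= g x by rewrite -fg powR_ge0.
have mEI : measurable (E `&` `[0%R, 1%R[ : set (measurableTypeR R)) by exact: measurableI.
have cwg : continuous (fun x => w x * g x) by exact: fun_continuousM.
rewrite meanE// /circle_integral.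
apply: (@le_trans _ _ (\int[mu]_(x in E `&` `[0%R, 1%R[) (w x * g x)%:E)%E).
  under eq_integral do rewrite fg.
  apply: ge0_le_integral => //=.
  - by move=> x _; rewrite lee_fin.
  - exact: measurable_int (integrable_itv mE cg).
  - exact: measurable_int (integrable_itv mE cwg).
  - by move=> x [Ex _]; rewrite lee_fin ler_peMl// wE.
apply: ge0_subset_integral => //.
- by have := measurable_int _ (integrable_itv measurableT cwg); rewrite setTI.
- by move=> x _; rewrite lee_fin mulr_ge0.
Qed.

End CircleIntegral.

(* Otherwise failing conversion tests unfold the integrals. *)
Opaque mean.

(** * Equally spaced translates and equidistribution *)

Section Translates.
Context {R : realType}.
Implicit Types (g : R -> R) (h : R -> R -> R) (e d t x y z : R) (Q M n : nat).

(** Q times the Riemann sum of g with step 1/Q started at t. *)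
Definition translates_sum Q g t : R := \sum_(i < Q) g (t + i%:R / Q%:R).

Lemma translates_sum_periodic Q g t : (0 < Q)%N -> (forall x, g (x + 1) = g x) ->
  translates_sum Q g (t + Q%:R^-1) = translates_sum Q g t.
Proof.
move=> Q0 pg; pose F i := g (t + i%:R / Q%:R).
rewrite /translates_sum [RHS](_ : _ = \sum_(i < Q) F i)//.
rewrite (eq_bigr (fun i : 'I_Q => F i.+1)); last first.
  by move=> i _; rewrite /F -addrA -{1}[Q%:R^-1]mul1r -mulrDl addrC nat1r addrC.
apply: (addIr (F 0%N)); rewrite addrC -(big_ord_recl _ (fun i : 'I_Q.+1 => F i)).
rewrite big_ord_recr/=; congr (_ + _).
by rewrite /F mul0r addr0 divff ?pnatr_eq0 ?lt0n_neq0.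
Qed.

(** The sum has period 1/Q, so each of its values is attained on [z, z + 1/Q], whatever the base
    point z. *)
Lemma translates_sum_reduce Q g z (P : R -> Prop) : (0 < Q)%N ->
  (forall x, g (x + 1) = g x) ->
  (forall r, 0 <= r <= Q%:R^-1 -> P (translates_sum Q g (z + r))) ->
  forall y, P (translates_sum Q g y).
Proof.
move=> Q0 pg H y; have Qgt0 : 0 < Q%:R :> R by rewrite ltr0n.
pose G u := translates_sum Q g (z + u / Q%:R).
have pG u : G (u + 1) = G u.
  by rewrite /G mulrDl mul1r addrA translates_sum_periodic.
set u := (y - z) * Q%:R; have := floor_itv u => /andP[f1 f2].
have -> : translates_sum Q g y = G (u - (Num.floor u)%:~R).
  rewrite -rmorphN/= periodic_int// /G mulfK ?gt_eqF//; congr translates_sum; ring.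
apply: H; rewrite intrD in f2; apply/andP; split.
  by apply: divr_ge0; [rewrite subr_ge0|exact: ltW].
by rewrite ler_pdivrMr// mulVf ?gt_eqF//; lra.
Qed.

Let continuous_shift g s : continuous g -> continuous (fun x => g (x + s)).
Proof.
move=> cg x; apply: (@continuous_comp _ _ _ (fun x => x + s) g); last exact: cg.
by apply: (@cvgD _ R^o); [exact: cvg_id|exact: cvg_cst].
Qed.

Lemma translates_sum_continuous Q g : continuous g -> continuous (translates_sum Q g).
Proof. by move=> cg; apply: continuous_sum => i; exact: continuous_shift. Qed.

Lemma mean_translates_sum Q g : continuous g -> (forall x, g (x + 1) = g x) ->
  mean (translates_sum Q g) = Q%:R * mean g.
Proof.
move=> cg pg; rewrite mean_sum => [|i]; last exact: continuous_shift.
under eq_bigr do rewrite mean_shift//.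
by rewrite sumr_const card_ord mulr_natl.
Qed.

Lemma exists_inv_nat_le d : 0 < d -> exists M, forall n, (M <= n)%N -> (0 < n)%N ->
  n%:R^-1 <= d.
Proof.
move=> d0; exists (Num.truncn d^-1).+1 => n Mn n0.
rewrite -(invrK d) lef_pV2 ?posrE ?ltr0n ?invr_gt0//.
by apply: ltW; apply: lt_le_trans (truncnS_gt _) _; rewrite ler_nat.
Qed.

(** For 1/Q at most d, one of the Q translates of any point lies within d of z modulo 1. Hence the
    sum of translates is everywhere at least g z / 2, and its mean is Q times that of g. *)
Lemma mean_gt0 g z : continuous g -> (forall x, g (x + 1) = g x) ->
  (forall x, 0 <= g x) -> 0 < g z -> 0 < mean g.
Proof.
move=> cg pg g0 gz.
have gz2 : 0 < g z / 2 by lra.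
have [d d0 gd] := heine_segment `|z| cg gz2.
have [Q0 HQ] := exists_inv_nat_le d0; set Q := Q0.+1.
have Qd : Q%:R^-1 <= d by apply: HQ; rewrite /Q.
have H y : g z / 2 <= translates_sum Q g y.
  apply: (@translates_sum_reduce Q g z (fun v => g z / 2 <= v)) => // r /andP[r0 rQ].
  rewrite /translates_sum big_ord_recl/= mul0r addr0 ler_wpDr ?sumr_ge0//.
  have := gd z (z + r) (lexx _); rewrite opprD addrA subrr sub0r normrN ger0_norm//.
  by move=> /(_ (le_trans rQ Qd)) /ler_normlP[]; lra.
rewrite -(@pmulr_rgt0 _ Q%:R) ?ltr0n// -mean_translates_sum//.
apply: lt_le_trans gz2 _; rewrite -[leLHS]mean_cst.
apply: le_mean => //; first exact: fun_continuous_cst.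
exact: translates_sum_continuous.
Qed.

(** The sum varies by at most Q e over its period 1/Q, hence differs by at most Q e from its own
    mean, which is Q times that of g. *)
Lemma translates_sum_dist g Q e : continuous g -> (forall x, g (x + 1) = g x) ->
  (0 < Q)%N -> (forall x y, `|x - y| <= Q%:R^-1 -> `|g x - g y| <= e) ->
  forall y, `|translates_sum Q g y - Q%:R * mean g| <= Q%:R * e.
Proof.
move=> cg pg Q0 ge y; rewrite -mean_translates_sum//.
rewrite -{1}(mean_cst (translates_sum Q g y)).
have ct := translates_sum_continuous (Q := Q) cg.
have cc := @fun_continuous_cst R.
rewrite -meanB//; apply: norm_mean_le; first exact: fun_continuousB.
apply: (@translates_sum_reduce Q g y
  (fun v => `|translates_sum Q g y - v| <= Q%:R * e)) => // r /andP[r0 rQ].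
rewrite /translates_sum -sumrB (le_trans (ler_norm_sum _ _ _))//.
rewrite mulr_natl -[leRHS](_ : \sum_(i < Q) e = _); last by rewrite sumr_const card_ord.
apply: ler_sum => i _; apply: ge.
by rewrite (_ : _ - _ = - r) ?normrN ?ger0_norm//; ring.
Qed.

Lemma buc_mean h : buc h -> buc (fun x _ => mean (h x)).
Proof.
move=> bh; have ch x := buc_continuousr (x := x) bh.
have [[B hB] uh] := bh; split.
  by exists B => x _; exact: norm_mean_le.
move=> e e0; have [d d0 hd] := uh e e0; exists d => // x x' y y' xx _.
rewrite -meanB//; apply: norm_mean_le => [|t]; first exact: fun_continuousB.
by apply: hd => //; rewrite subrr normr0 ltW.
Qed.

(** Shifting x by i / M^2 for i < M leaves the mean unchanged. It moves the first argument by at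
    most 1/M, while M x is shifted by i / M, so averaging over i turns the second argument into a
    Riemann sum for [mean (h x)]. *)
Lemma mean_diagonal h e : buc h ->
  (forall x y, h (x + 1) y = h x y) -> (forall x y, h x (y + 1) = h x y) -> 0 < e ->
  exists M0, forall M, (M0 <= M)%N ->
    `|mean (fun x => h x (M%:R * x)) - mean (fun x => mean (h x))| <= e.
Proof.
move=> bh px py e0; have e20 : 0 < e / 2 by lra.
have [d d0 hd] := bh.2 _ e20.
have [M0 HM] := exists_inv_nat_le d0; exists M0.+1 => M M0M.
have Mpos : (0 < M)%N by exact: leq_trans M0M.
have Mgt0 : 0 < M%:R :> R by rewrite ltr0n.
have Md : M%:R^-1 <= d by apply: HM => //; exact: ltnW.
pose g x := h x (M%:R * x).
have pyn n x y : h x (y + n%:R) = h x y.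
  by elim: n => [|n IHn]; rewrite ?addr0// -natr1 addrA py.
have pg x : g (x + 1) = g x by rewrite /g px mulrDr mulr1 pyn.
have bg : buc (fun x _ => g x).
  apply: eq_buc (buc_affine 1 0 0 M%:R 0 0 bh) => x y.
  by rewrite /g !mul0r !addr0 mul1r.
have cg : continuous g := buc_continuous (y := 0) bg.
have cc := @fun_continuous_cst R.
have cH := buc_continuous (y := 0) (buc_mean bh).
have c1 i : continuous (fun x => g (x + i%:R / (M%:R * M%:R))).
  exact: continuous_shift.
have E : M%:R * mean g = mean (fun x => \sum_(i < M) g (x + i%:R / (M%:R * M%:R))).
  rewrite mean_sum => [|i]; last exact: c1.
  by under eq_bigr do rewrite mean_shift//; rewrite sumr_const card_ord mulr_natl.
rewrite -(ler_pM2l Mgt0) -{1}(gtr0_norm Mgt0) -normrM mulrBr E -meanZ//.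
have cs : continuous (fun x => \sum_(i < M) g (x + i%:R / (M%:R * M%:R))).
  by apply: continuous_sum => i; exact: c1.
have cMH : continuous (fun x => M%:R * mean (h x)).
  exact: fun_continuousM.
rewrite -meanB//; apply: norm_mean_le => [|x]; first exact: fun_continuousB.
(* The first sum is the cost of freezing the first argument at x, the second term the error of the
   Riemann sum; each is at most M e / 2. *)
rewrite (_ : _ - _ = \sum_(i < M) (g (x + i%:R / (M%:R * M%:R))
     - h x (M%:R * x + i%:R / M%:R)) +
   (translates_sum M (h x) (M%:R * x) - M%:R * mean (h x))); last first.
  by rewrite sumrB /translates_sum addrA subrK.
rewrite (le_trans (ler_normD _ _))//.
have -> : M%:R * e = M%:R * (e / 2) + M%:R * (e / 2) by field.
apply: lerD; last first.
  apply: translates_sum_dist => //; first exact: buc_continuousr.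
  move=> y y' yy; apply: hd; first by rewrite subrr normr0 ltW.
  exact: (le_trans yy Md).
rewrite (le_trans (ler_norm_sum _ _ _))//.
have -> : M%:R * (e / 2) = \sum_(i < M) (e / 2).
  by rewrite sumr_const card_ord mulr_natl.
apply: ler_sum => i _; rewrite /g.
have -> : M%:R * (x + i%:R / (M%:R * M%:R)) = M%:R * x + i%:R / M%:R.
  by field; rewrite gt_eqF.
apply: hd; last by rewrite subrr normr0 ltW.
rewrite addrAC subrr add0r ger0_norm ?divr_ge0// ?mulr_ge0//.
apply: le_trans Md; rewrite ler_pdivrMr ?mulr_gt0// mulrA mulVf ?gt_eqF// mul1r.
by rewrite ler_nat ltnW.
Qed.

End Translates.

(** * The profile of the trinomial *)

Section Trinomial.
Context {R : realType}.
Implicit Types (l m s t th x y z : R).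

Definition cosc t : R := cos (2 * pi * t).

Lemma coscD1 t : cosc (t + 1) = cosc t.
Proof. by rewrite /cosc mulrDr mulr1 mulr_natl cosD2pi. Qed.

Lemma coscDhalf t : cosc (t + 2^-1) = - cosc t.
Proof.
by rewrite /cosc mulrDr (_ : 2 * pi / 2 = pi) ?cosDpi//; field.
Qed.

Lemma coscDn t n : cosc (t + n%:R) = cosc t.
Proof. by elim: n => [|n IHn]; rewrite ?addr0// -natr1 addrA coscD1. Qed.

Lemma cosc0 : cosc 0 = 1. Proof. by rewrite /cosc mulr0 cos0. Qed.

(* |1 + e(y) + e(2y + th)|^2 *)
Definition trinomial_sqr th y : R :=
  3 + 2 * cosc y + 2 * cosc (y + th) + 2 * cosc (2 * y + th).

(** The exponent s stands for p / 2. *)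
Definition trinomial_powR s th y : R := `|trinomial_sqr th y| `^ s.

Definition profile s th : R := mean (trinomial_powR s th).

Definition reduced s l : R :=
  mean (fun z => `|1 + 4 * cosc z ^+ 2 + l * (4 * cosc z)| `^ s).

Lemma buc_cosc a b c : buc (fun x y => cosc (a * x + b * y + c)).
Proof.
apply: eq_buc (buc_cos_affine (2 * pi * a) (2 * pi * b) (2 * pi * c)) => x y.
by rewrite /cosc !mulrDr !mulrA.
Qed.

Lemma continuous_cosc : continuous cosc.
Proof.
apply: eq_fun_continuous (buc_continuous (y := 0) (buc_cosc 1 0 0)) => x /=.
by rewrite mul0r !addr0 mul1r.
Qed.

Lemma buc_trinomial_powR s (K : R) : 0 < s -> buc (fun x y => trinomial_powR s (K * x) y).
Proof.
move=> s0; apply: (buc_comp (continuous_norm_powR s0)).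
have b2 a b : buc (fun x y => 2 * cosc (a * x + b * y + 0)).
  by apply: bucM; [exact: buc_cst|exact: buc_cosc].
apply: bucD; last by apply: eq_buc (b2 K 2) => x y; rewrite addr0 addrC.
apply: bucD; last by apply: eq_buc (b2 K 1) => x y; rewrite addr0 addrC mul1r.
apply: bucD; first exact: buc_cst.
by apply: eq_buc (b2 0 1) => x y; rewrite addr0 mul0r add0r mul1r.
Qed.

Lemma trinomial_powRD1 s th y : trinomial_powR s th (y + 1) = trinomial_powR s th y.
Proof.
rewrite /trinomial_powR /trinomial_sqr coscD1 [y + 1 + th]addrAC coscD1.
by rewrite (_ : 2 * (y + 1) + th = 2 * y + th + 2) ?coscDn//; ring.
Qed.

Lemma trinomial_powRDn s th n y : trinomial_powR s (th + n%:R) y = trinomial_powR s th y.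
Proof. by rewrite /trinomial_powR /trinomial_sqr !addrA !coscDn. Qed.

Lemma trinomial_powR_ge0 s th y : 0 <= trinomial_powR s th y.
Proof. exact: powR_ge0. Qed.

Lemma continuous_trinomial_powR s th : 0 < s -> continuous (trinomial_powR s th).
Proof.
move=> s0; have := buc_continuousr (x := th) (buc_trinomial_powR 1 s0).
apply: eq_fun_continuous => y.
by rewrite mul1r.
Qed.

Lemma profileDn s th n : profile s (th + n%:R) = profile s th.
Proof. by congr mean; apply/funext => y; rewrite trinomial_powRDn. Qed.

(** Centring at y = z - th / 2, with w = 2 pi z, makes the two linear terms add up to 4 cos(pi th)
    cos w, and 3 + 2 cos(2 w) = 1 + 4 cos^2 w. *)
Lemma profile_reduced s th : 0 < s -> profile s th = reduced s (cos (pi * th)).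
Proof.
move=> s0; rewrite /profile -(mean_shift (- (th / 2))); last 2 first.
- exact: continuous_trinomial_powR.
- by move=> x; exact: trinomial_powRD1.
congr mean; apply/funext => z; rewrite /trinomial_powR /trinomial_sqr; congr (`|_| `^ _).
rewrite (_ : 2 * _ + th = z + z); last by field.
rewrite (_ : z - th / 2 + th = z + th / 2); last by field.
rewrite /cosc; set w := 2 * pi * z.
have -> : 2 * pi * (z - th / 2) = w - pi * th by rewrite /w; field.
have -> : 2 * pi * (z + th / 2) = w + pi * th by rewrite /w; field.
have -> : 2 * pi * (z + z) = w + w by rewrite /w; ring.
rewrite cosB !cosD.
have := cos2Dsin2 w => h.
have -> : sin w * sin w = 1 - cos w ^+ 2.
  by rewrite -h; ring.
ring.
Qed.

Let sym s l z := `|1 + 4 * cosc z ^+ 2 + l * (4 * cosc z)| `^ s +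
                 `|1 + 4 * cosc z ^+ 2 - l * (4 * cosc z)| `^ s.

Let continuous_half s l : 0 < s ->
  continuous (fun z => `|1 + 4 * cosc z ^+ 2 + l * (4 * cosc z)| `^ s).
Proof.
move=> s0 z.
apply: (@continuous_comp _ _ _ (fun z => 1 + 4 * cosc z ^+ 2 + l * (4 * cosc z))
  (fun x => `|x| `^ s)); last exact: continuous_norm_powR.
move: z.
have cc := @fun_continuous_cst R; have cs := continuous_cosc.
apply: fun_continuousD; last by do 2!apply: fun_continuousM => //.
apply: fun_continuousD => //; apply: fun_continuousM => //.
exact: fun_continuousM.
Qed.

Let continuous_sym s l : 0 < s -> continuous (sym s l).
Proof.
move=> s0; apply: fun_continuousD; first exact: continuous_half.
by apply: eq_fun_continuous (continuous_half (l := - l) s0) => z; rewrite mulNr.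
Qed.

(** Shifting z by 1/2 changes the sign of [cosc z], so l and -l give the same mean. *)
Let reduced_sym s l : 0 < s -> 2 * reduced s l = mean (sym s l).
Proof.
move=> s0; rewrite /sym meanD; last 2 first.
- exact: continuous_half.
- by apply: eq_fun_continuous (continuous_half (l := - l) s0) => z; rewrite mulNr.
rewrite mulr_natl mulr2n; congr (_ + _).
rewrite /reduced -(mean_shift (2^-1)); last 2 first.
- exact: continuous_half.
- by move=> x; rewrite coscD1.
by congr mean; apply/funext => z; rewrite coscDhalf sqrrN !mulrN.
Qed.

Let symD1 s l z : sym s l (z + 1) = sym s l z.
Proof. by rewrite /sym coscD1. Qed.

Let sym_norm s l z : sym s l z =
  `|1 + 4 * cosc z ^+ 2 + `|l| * `|4 * cosc z| | `^ s +
  `|1 + 4 * cosc z ^+ 2 - `|l| * `|4 * cosc z| | `^ s.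
Proof.
rewrite /sym -normrM.
by have [_|_] := ger0P (l * (4 * cosc z)); rewrite // opprK addrC.
Qed.

(** The sign e, taken as 1 or -1, treats the convex and concave cases together. The hypothesis is
    applied pointwise with a = 1 + 4 C^2 and C = [cosc z]; it gives a strict inequality wherever C
    is nonzero, in particular at z = 0. *)
Let reduced_lt_gen (e : R) s l m : 0 < s ->
  (forall a x y : R, 0 <= x -> x < y -> y <= a ->
    e * (`|a + x| `^ s + `|a - x| `^ s) < e * (`|a + y| `^ s + `|a - y| `^ s)) ->
  `|l| < `|m| -> `|m| <= 1 -> e * reduced s l < e * reduced s m.
Proof.
move=> s0 H lm m1.
have c l' : continuous (fun z => e * sym s l' z).
  by apply: fun_continuousM; [exact: fun_continuous_cst|exact: continuous_sym].
have cs l' : continuous (sym s l') by exact: continuous_sym.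
suff : 0 < mean (fun z => e * sym s m z - e * sym s l z).
  rewrite (meanB (c m) (c l)) (meanZ e (cs m)) (meanZ e (cs l)).
  rewrite -(reduced_sym m s0) -(reduced_sym l s0).
  by move: (reduced s l) (reduced s m) => u v; lra.
have lt z : cosc z != 0 -> e * sym s l z < e * sym s m z.
  move=> z0; rewrite !sym_norm; apply: H.
  - exact: mulr_ge0.
  - by rewrite ltr_pM2r// normr_gt0 mulf_neq0.
  (* The condition y <= a reads 4 |C| <= 1 + 4 C^2, that is, (2 |C| - 1)^2 >= 0. *)
  - apply: le_trans (ler_wpM2r (normr_ge0 _) m1) _.
    rewrite mul1r normrM (ger0_norm (ler0n _ 4)) -(real_normK (num_real (cosc z))).
    have := sqr_ge0 (2 * `|cosc z| - 1); nra.
apply: (@mean_gt0 _ _ 0).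
- exact: fun_continuousB.
- by move=> x; rewrite !symD1.
- move=> z; rewrite subr_ge0; have [z0|/lt/ltW//] := eqVneq (cosc z) 0.
  by rewrite /sym z0 !mulr0.
- by rewrite subr_gt0 lt// cosc0 oner_neq0.
Qed.

Lemma reduced_lt s l m : 1 < s -> `|l| < `|m| -> `|m| <= 1 ->
  reduced s l < reduced s m.
Proof.
move=> s1 lm m1; rewrite -[ltLHS]mul1r -[ltRHS]mul1r.
apply: reduced_lt_gen => // [|a x y x0 xy ya]; first lra.
by rewrite !mul1r; exact: powR_sym_sum_lt_convex.
Qed.

Lemma reduced_gt s l m : 0 < s < 1 -> `|l| < `|m| -> `|m| <= 1 ->
  reduced s m < reduced s l.
Proof.
move=> s1 lm m1; rewrite -ltrN2 -[ltLHS]mulN1r -[ltRHS]mulN1r.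
apply: reduced_lt_gen => // [|a x y x0 xy ya]; first lra.
by rewrite !mulN1r ltrN2; exact: powR_sym_sum_lt_concave.
Qed.

Lemma reduced_norm s l : 0 < s -> reduced s `|l| = reduced s l.
Proof.
move=> s0; have two0 : 2 != 0 :> R by rewrite pnatr_eq0.
have E : sym s `|l| = sym s l.
  by apply/funext => z; rewrite sym_norm (sym_norm s l) normr_id.
have := reduced_sym `|l| s0; rewrite E -(reduced_sym l s0).
exact: (mulfI two0).
Qed.

Lemma profile_gt0 s th : 0 < s -> 0 < profile s th.
Proof.
move=> s0; apply: (@mean_gt0 _ _ 0).
- exact: continuous_trinomial_powR.
- by move=> x; exact: trinomial_powRD1.
- by move=> x; exact: trinomial_powR_ge0.
apply: powR_gt0; rewrite normr_gt0 /trinomial_sqr mulr0 add0r cosc0.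
have := cos_geN1 (2 * pi * th); rewrite -/(cosc th) => ?.
by rewrite gt_eqF//; lra.
Qed.

Opaque reduced profile.

(* [q] measures the distance to the maximum point [th0] of the profile, which is
   0 for p > 2 and 1/2 for p < 2. *)
Lemma profile_peak s : 0 < s -> s != 1 -> exists (q : R -> R) th0,
  [/\ q th0 = 0, (forall th, 0 <= q th),
   (forall th th', q th <= q th' -> profile s th' <= profile s th),
   (forall th th', q th < q th' -> profile s th' < profile s th) &
   (forall th th', `|sin (pi * (th - th'))| <= q th + q th') /\
   (forall t, 0 < t <= 1 -> exists th, q th = t)].
Proof.
move=> s0 s1.
have pi0 : pi != 0 :> R by rewrite gt_eqF ?pi_gt0.
have sB th th' : `|sin (pi * (th - th'))| <=
    `|sin (pi * th)| * `|cos (pi * th')| + `|cos (pi * th)| * `|sin (pi * th')|.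
  by rewrite mulrBr sinB -!normrM ler_normB.
have sc x : `|sin x| ^+ 2 + `|cos x| ^+ 2 = 1.
  by rewrite !real_normK ?num_real// addrC cos2Dsin2.
have sc_le x y : `|sin x| <= `|sin y| -> `|cos y| <= `|cos x|.
  have := sc x; have := sc y; have := normr_ge0 (sin x); have := normr_ge0 (cos x).
  have := normr_ge0 (cos y) => *; rewrite leNgt; apply/negP => ?; nra.
have sc_lt x y : `|sin x| < `|sin y| -> `|cos y| < `|cos x|.
  have := sc x; have := sc y; have := normr_ge0 (sin x); have := normr_ge0 (cos x).
  have := normr_ge0 (cos y) => *; rewrite ltNge; apply/negP => ?; nra.
have leP (q : R -> R) : (forall th th', q th < q th' -> profile s th' < profile s th) ->
    (forall th th', q th = q th' -> profile s th' = profile s th) ->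
    forall th th', q th <= q th' -> profile s th' <= profile s th.
  by move=> ql qe th th'; rewrite le_eqVlt => /predU1P[/qe->//|/ql/ltW].
(* The profile increases with |cos(pi th)| if s > 1 and decreases if s < 1, so the distance q is
   |sin(pi th)| in the first case and |cos(pi th)| in the second. *)
have [s1'|s1'] := ltP 1 s.
- have ql th th' : `|sin (pi * th)| < `|sin (pi * th')| -> profile s th' < profile s th.
    move=> H; rewrite !profile_reduced//.
    by apply: reduced_lt => //; [exact: sc_lt|exact: cos_max].
  exists (fun th => `|sin (pi * th)|), 0; split.
  + by rewrite mulr0 sin0 normr0.
  + by move=> th; exact: normr_ge0.
  + apply: (leP (fun th => `|sin (pi * th)|)); [exact: ql|move=> th th' e].
    rewrite !(profile_reduced _ s0) -(reduced_norm _ s0) -[RHS](reduced_norm _ s0).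
    congr reduced.
    by apply/eqP; rewrite eq_le !sc_le ?e.
  + exact: ql.
  + split=> [th th'|t t1].
      apply: le_trans (sB th th') _; apply: lerD.
        by rewrite ler_piMr// cos_max.
      by rewrite ler_piMl// cos_max.
    exists (asin t / pi); rewrite mulrC divfK// asinK ?in_itv/=; last lra.
    by rewrite ger0_norm; lra.
- have s2 : 0 < s < 1 by rewrite s0 lt_neqAle s1.
  have ql th th' : `|cos (pi * th)| < `|cos (pi * th')| -> profile s th' < profile s th.
    by move=> H; rewrite !profile_reduced//; apply: reduced_gt => //; exact: cos_max.
  exists (fun th => `|cos (pi * th)|), 2^-1; split.
  + by rewrite cos_pihalf normr0.
  + by move=> th; exact: normr_ge0.
  + apply: (leP (fun th => `|cos (pi * th)|)); [exact: ql|move=> th th' e].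
    by rewrite !(profile_reduced _ s0) -(reduced_norm _ s0) -[RHS](reduced_norm _ s0) e.
  + exact: ql.
  + split=> [th th'|t t1].
      apply: le_trans (sB th th') _; rewrite addrC; apply: lerD.
        by rewrite ler_piMr// sin_max.
      by rewrite ler_piMl// sin_max.
    exists (acos t / pi); rewrite mulrC divfK// acosK ?in_itv/=; last lra.
    by rewrite ger0_norm; lra.
Qed.

End Trinomial.

(** * Lacunary products *)

Section GappedSums.
Context {R : realType}.
Implicit Types (s t : seq nat) (r x y : R) (w : R -> R) (K M N : nat).

(** With sequences of frequencies, a product of two sums is again such a sum; distinctness of the
    frequencies is recovered from the gaps. *)
Definition exp_seq s x : R[i] := \sum_(h <- s) expi (h%:R * x).

Definition sqr_modulus (z : R[i]) : R := let: Complex a b := z in a ^+ 2 + b ^+ 2.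

Definition exp_seq_sqr s x : R :=
  \sum_(h <- s) \sum_(k <- s) cosc (h%:R * x - k%:R * x).

Lemma normc_powR (z : R[i]) p :
  ComplexField.Normc.normc z `^ p = `|sqr_modulus z| `^ (p / 2).
Proof.
case: z => a b; rewrite /= mulrC powRrM powR12_sqrt ?normr_ge0//.
by rewrite ger0_norm// addr_ge0 ?sqr_ge0.
Qed.

Lemma sqr_modulusM : {morph sqr_modulus : z z' / z * z'}.
Proof. by move=> [a b] [c d] /=; ring. Qed.

Lemma sqr_modulus_ge0 z : 0 <= sqr_modulus z.
Proof. by case: z => a b; rewrite addr_ge0 ?sqr_ge0. Qed.

Lemma expiD x y : expi (x + y) = expi x * expi y.
Proof.
rewrite /expi mulrDr cosD sinD; apply/eqP; rewrite eq_complex/= eqxx/=.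
by rewrite addrC mulrC [X in _ + X]mulrC [X in X + _]mulrC.
Qed.

Lemma exp_seqE s x : exp_seq s x =
  Complex (\sum_(h <- s) cos (2 * pi * (h%:R * x)))
          (\sum_(h <- s) sin (2 * pi * (h%:R * x))).
Proof. by rewrite /exp_seq; elim: s => [|h s IHs]; rewrite ?big_nil// !big_cons IHs. Qed.

Lemma sqr_modulus_exp_seq s x : sqr_modulus (exp_seq s x) = exp_seq_sqr s x.
Proof.
rewrite exp_seqE /= !expr2 !big_distrlr -big_split; apply: eq_bigr => h _ /=.
rewrite -big_split; apply: eq_bigr => k _ /=.
by rewrite /cosc mulrBr cosB.
Qed.

Lemma exp_seq_sqr_ge0 s x : 0 <= exp_seq_sqr s x.
Proof. by rewrite -sqr_modulus_exp_seq sqr_modulus_ge0. Qed.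

Lemma exp_seq_allpairs s t x :
  exp_seq [seq (k + h)%N | k <- t, h <- s] x = exp_seq t x * exp_seq s x.
Proof.
rewrite /exp_seq big_allpairs_dep big_distrlr; apply: eq_bigr => k _.
by apply: eq_bigr => h _; rewrite natrD mulrDl expiD.
Qed.

(** The new factor is 1 + e(M x) + e((2 M + K) x), the trinomial with y = M x and theta = K x. *)
Lemma exp_seq_sqr_step s K M x :
  exp_seq_sqr [seq (k + h)%N | k <- [:: 0%N; M; (2 * M + K)%N], h <- s] x =
  trinomial_sqr (K%:R * x) (M%:R * x) * exp_seq_sqr s x.
Proof.
rewrite -sqr_modulus_exp_seq exp_seq_allpairs sqr_modulusM !sqr_modulus_exp_seq.
congr (_ * _); rewrite /exp_seq_sqr !big_cons !big_nil !addr0 !subrr cosc0.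
have coscN (y : R) : cosc (- y) = cosc y by rewrite /cosc mulrN cosN.
rewrite /trinomial_sqr mul0r !subr0 !sub0r !coscN natrD natrM.
have -> : M%:R * x - (2 * M%:R + K%:R) * x = - (M%:R * x + K%:R * x) by ring.
have -> : (2 * M%:R + K%:R) * x - M%:R * x = M%:R * x + K%:R * x by ring.
have -> : (2 * M%:R + K%:R) * x = 2 * (M%:R * x) + K%:R * x by ring.
rewrite coscN; ring.
Qed.

Lemma buc_exp_seq_sqr s : buc (fun x _ => exp_seq_sqr s x).
Proof.
have bs (F : nat -> R -> R -> R) : (forall i, buc (F i)) ->
    buc (fun x y => \sum_(i <- s) F i x y).
  move=> bF; elim: s => [|j r IHr].
    by apply: eq_buc (buc_cst 0) => x y; rewrite big_nil.
  by apply: eq_buc (bucD (bF j) IHr) => x y; rewrite big_cons.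
apply: (bs (fun h x _ => \sum_(k <- s) cosc (h%:R * x - k%:R * x))) => h.
apply: (bs (fun k x _ => cosc (h%:R * x - k%:R * x))) => k.
by apply: eq_buc (buc_cosc (h%:R - k%:R) 0 0) => x y; congr cosc; ring.
Qed.

Lemma exp_seq_sqrD1 s x : exp_seq_sqr s (x + 1) = exp_seq_sqr s x.
Proof.
apply: eq_bigr => h _; apply: eq_bigr => k _.
have -> : h%:R * (x + 1) - k%:R * (x + 1) = h%:R * x - k%:R * x + (h%:R - k%:R) by ring.
have -> : h%:R - k%:R = (h%:Z - k%:Z)%:~R :> R by rewrite rmorphB.
by rewrite periodic_int//; exact: coscD1.
Qed.

Definition gapped N s := pairwise (fun a b => (a + N < b)%N) s.

(** The new sequence consists of copies of s placed at 0, M and 2 M + K; as M exceeds N plus the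
    largest entry, each copy begins more than N after the previous one ends. *)
Lemma gapped_step N K M s : gapped N s -> (N + \max_(h <- s) h < M)%N ->
  gapped N [seq (k + h)%N | k <- [:: 0%N; M; (2 * M + K)%N], h <- s].
Proof.
move=> gs NM; have sB h : h \in s -> (h + N < M)%N.
  by move=> hs; apply: leq_ltn_trans NM; rewrite addnC leq_add2l leq_bigmax_seq.
have gk k : pairwise (fun a b => (a + N < b)%N) [seq (k + h)%N | h <- s].
  rewrite pairwise_map; apply: sub_pairwise gs => a b /=; lia.
rewrite /gapped /= cats0 !pairwise_cat !allrel_catr !gk !andbT/=.
by apply/andP; split; [apply/andP; split|];
  apply/allrelP => _ _ /mapP[a /sB ? ->] /mapP[b /sB ? ->]; lia.
Qed.

(** Induction on [Ks] for all weights w, of any sign: the profile of the first K is absorbed into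
    the weight, and the sequence obtained is then multiplied by a trinomial with large M.
    Equidistribution of M x replaces that profile by the trinomial itself; only positivity has to
    survive, so an error of half the mean is allowed. *)
Lemma exists_gapped (sg : R) (Ks : seq nat) w : 0 < sg ->
  buc (fun x _ => w x) -> (forall x, w (x + 1) = w x) ->
  0 < mean (fun x => w x * \prod_(K <- Ks) profile sg (K%:R * x)) ->
  forall N, exists s, [/\ s != [::], gapped N s &
    0 < mean (fun x => w x * `|exp_seq_sqr s x| `^ sg)].
Proof.
move=> sg0; elim: Ks w => [|K Ks IHKs] w bw pw.
  under eq_fun do rewrite big_nil mulr1; move=> w0 N; exists [:: 0%N]; split => //.
  under eq_fun do rewrite /exp_seq_sqr !big_seq1 subrr cosc0 normr1 powR1 mulr1.
  exact: w0.
under eq_fun do rewrite big_cons mulrA; move=> w0 N.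
have bP : buc (fun x _ => profile sg (K%:R * x)).
  exact: buc_mean (buc_trinomial_powR K%:R sg0).
have bwP := bucM bw bP.
have pP x : profile sg (K%:R * (x + 1)) = profile sg (K%:R * x).
  by rewrite mulrDr mulr1 profileDn.
have [|s [s0 gs ws]] := IHKs _ bwP _ w0 N; first by move=> x; rewrite pw pP.
have bm := buc_comp (continuous_norm_powR sg0) (buc_exp_seq_sqr s).
have bh := bucM (bucM bw bm) (buc_trinomial_powR K%:R sg0).
set c := mean _ in ws; have c2 : 0 < c / 2 by lra.
have [||M0 HM] := mean_diagonal bh _ _ c2.
- by move=> x y; rewrite pw exp_seq_sqrD1 mulrDr mulr1 trinomial_powRDn.
- by move=> x y; rewrite trinomial_powRD1.
(* M is large enough both for equidistribution and for the gaps. *)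
pose M := maxn M0 (N + \max_(h <- s) h).+1.
have := HM M (leq_maxl _ _).
have -> : mean (fun x => mean (fun y => w x * `|exp_seq_sqr s x| `^ sg *
    trinomial_powR sg (K%:R * x) y)) = c.
  congr mean; apply/funext => x; rewrite meanZ; last exact: continuous_trinomial_powR.
  by rewrite -/(profile _ _) mulrAC.
move=> /ler_normlP[cM _].
exists [seq (k + h)%N | k <- [:: 0%N; M; (2 * M + K)%N], h <- s]; split.
- by rewrite -size_eq0 size_allpairs muln_eq0 /= size_eq0 (negbTE s0).
- by apply: gapped_step => //; rewrite leq_max leqnn orbT.
rewrite (_ : (fun x => _) = (fun x => w x * `|exp_seq_sqr s x| `^ sg *
    trinomial_powR sg (K%:R * x) (M%:R * x))); last first.
  apply/funext => x; rewrite exp_seq_sqr_step normrM powRM//.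
  by rewrite -/(trinomial_powR _ _ _) mulrCA mulrC.
by move: cM; lra.
Qed.

End GappedSums.

(** * Cutoffs and peaked products *)

Section Weights.
Context {R : realType}.
Implicit Types (u x y c k : R).

(** The truncation of u to [0, 1], written with absolute values so that continuity is immediate. *)
Definition clamp u : R := (`|u| - `|u - 1| + 1) / 2.

Lemma clamp_itv u : 0 <= clamp u <= 1.
Proof.
rewrite /clamp; have [?|?] := ger0P u; have [?|?] := ger0P (u - 1);
  apply/andP; split; lra.
Qed.

Lemma clamp_le0 u : u <= 0 -> clamp u = 0.
Proof. by move=> u0; rewrite /clamp !ler0_norm; lra. Qed.

Lemma clamp_ge1 u : 1 <= u -> clamp u = 1.
Proof. by move=> u0; rewrite /clamp !ger0_norm; lra. Qed.

Let continuous_norm : continuous (fun x : R => `|x|).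
Proof. by move=> x; exact: norm_continuous. Qed.

Lemma continuous_clamp : continuous clamp.
Proof.
apply: fun_continuousM; last exact: fun_continuous_cst.
apply: fun_continuousD; last exact: fun_continuous_cst.
apply: fun_continuousB => // x.
apply: (@continuous_comp _ _ _ (fun x => x - 1) (fun x => `|x|));
  last exact: continuous_norm.
move: x; apply: fun_continuousB; last exact: fun_continuous_cst.
by move=> x; exact: cvg_id.
Qed.

Definition sin_sqr x : R := (1 - cosc x) / 2.

Lemma sin_sqrE x : sin_sqr x = `|sin (pi * x)| ^+ 2.
Proof.
rewrite real_normK ?num_real// /sin_sqr /cosc.
have -> : 2 * pi * x = (pi * x) *+ 2 by rewrite -mulr_natr; ring.
by rewrite cos_mulr2n cos2sin2 -mulr_natr; field.
Qed.

(** A periodic bump around the integers, equal to 1 where sin^2(pi x) <= k / 2 and to 0 where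
    sin^2(pi x) >= k. *)
Definition cutoff k x : R := clamp (2 - 2 * sin_sqr x / k).

Lemma cutoffD1 k x : cutoff k (x + 1) = cutoff k x.
Proof. by rewrite /cutoff /sin_sqr coscD1. Qed.

Lemma buc_cutoff k : buc (fun x _ => cutoff k x).
Proof.
apply: (buc_comp continuous_clamp).
have := bucD (buc_cst (2 - k^-1)) (bucM (buc_cst k^-1) (buc_cosc 1 0 (0 : R))).
apply: eq_buc => x y; rewrite /sin_sqr mul0r !addr0 mul1r.
have -> : 2 * ((1 - cosc x) / 2) = 1 - cosc x by field.
ring.
Qed.

Lemma cutoff_eq1 k x : 0 < k -> sin_sqr x <= k / 2 -> cutoff k x = 1.
Proof.
move=> k0 xk; apply: clamp_ge1.
have : 2 * sin_sqr x / k <= 1 by rewrite ler_pdivrMr//; lra.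
lra.
Qed.

Lemma cutoff_eq0 k x : 0 < k -> k <= sin_sqr x -> cutoff k x = 0.
Proof.
move=> k0 xk; apply: clamp_le0.
have : 2 <= 2 * sin_sqr x / k by rewrite ler_pdivlMr//; lra.
lra.
Qed.

Lemma bernoulli_ge (t : R) n : 1 <= t -> n%:R * (t - 1) <= t ^+ n.
Proof.
move=> t1; suff: 1 + n%:R * (t - 1) <= t ^+ n by lra.
elim: n => [|n IHn]; first by rewrite mul0r addr0 expr0.
have t0 : 0 <= t by lra.
rewrite exprS -natr1; apply: le_trans (ler_wpM2l t0 IHn).
have : 0 <= n%:R * (t - 1) ^+ 2 by rewrite mulr_ge0 ?sqr_ge0.
by rewrite expr2; lra.
Qed.

(** The quotient by 2 is the positive part of t - 1. For t > 1 Bernoulli's inequality gives growth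
    linear in n; for t <= 1 the positive part vanishes and the loss is at most c. *)
Lemma weighted_power_ge (t b c : R) n : 0 <= t -> 0 <= c < 1 -> 0 <= b ->
  (1 < t -> b = 1) ->
  n%:R * (1 - c) * ((`|t - 1| + (t - 1)) / 2) - c <= (b - c) * t ^+ n.
Proof.
move=> t0 /andP[c0 c1] b0 bt.
have tn0 : 0 <= t ^+ n by rewrite exprn_ge0.
have [t1|t1] := ltP 1 t.
  have tn := bernoulli_ge n (ltW t1); have c1' : 0 <= 1 - c by lra.
  rewrite bt// ger0_norm; last lra.
  have -> : (t - 1 + (t - 1)) / 2 = t - 1 by field.
  rewrite mulrAC; apply: le_trans (_ : t ^+ n * (1 - c) <= _); last by rewrite mulrC.
  by rewrite -[leRHS]subr0 lerB// ler_wpM2r.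
rewrite ler0_norm; last lra.
have -> : (- (t - 1) + (t - 1)) / 2 = 0 by ring.
have tn1 : t ^+ n <= 1 by rewrite exprn_ile1.
rewrite mulr0 sub0r mulrBl; have := mulr_ge0 b0 tn0; have := ler_wpM2l c0 tn1.
move: (b * _) (c * t ^+ n) => u v; lra.
Qed.

(* Both [K x] and [K.+1 x] are close to the maximum point [th0] of [P]
   only if their difference [x] is close to 0, whereas [x = th0 / K] is such a
   point when [K] is large. *)
Lemma exists_peaked_product (P q : R -> R) (th0 c k : R) :
  buc (fun x _ => P x) -> (forall x n, P (x + n%:R) = P x) -> (forall x, 0 < P x) ->
  q th0 = 0 -> (forall x, 0 <= q x) ->
  (forall x y, q x <= q y -> P y <= P x) -> (forall x y, q x < q y -> P y < P x) ->
  (forall x y, `|sin (pi * (x - y))| <= q x + q y) ->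
  (forall t, 0 < t <= 1 -> exists x, q x = t) ->
  0 <= c < 1 -> 0 < k <= 1 -> exists Ks : seq nat,
  0 < mean (fun x => (cutoff k x - c) * \prod_(K <- Ks) P (K%:R * x)).
Proof.
move=> bucP PDn P_gt0 q0 q_ge0 qle qlt qsin qsurj /andP[c0 c1] /andP[k0 k1].
have [th1 qth1] : exists th, q th = k / 4 by apply: qsurj; lra.
set b0 := P th0; set b1 := P th1.
have b10 : b1 < b0 by apply: qlt; rewrite q0 qth1; lra.
have b1gt0 : 0 < b1 by exact: P_gt0.
have pb0 x : P x <= b0 by apply: qle; rewrite q0.
have [_ bP] := bucP.
have bbgt0 : 0 < (b0 - b1) / 2 by lra.
have [d d0 Pd] := bP _ bbgt0.
have th_gt0 : 0 < `|th0| + 1 by rewrite ltr_wpDl.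
(* This makes |th0| / K at most d; the added 1 keeps the divisor positive when th0 = 0. *)
have [K0 HK] := @exists_inv_nat_le R (d / (`|th0| + 1)) (divr_gt0 d0 th_gt0).
set K := K0.+1; have {}HK : K%:R^-1 <= d / (`|th0| + 1) by apply: HK; rewrite /K.
have Kgt0 : 0 < K%:R :> R by rewrite ltr0n.
pose Psi x := P (K%:R * x) * P (K.+1%:R * x).
set m := b1 * b0; have m0 : 0 < m by apply: mulr_gt0; lra.
have Psi_ge0 x : 0 <= Psi x by apply: mulr_ge0; apply: ltW.
(* Since k <= 1, such an x has |sin(pi x)| > k / 2. By [qsin] one of q(K x), q(K.+1 x) is then at
   least k / 4 = q(th1), so one factor is at most b1 and the other at most b0. *)
have Psi_le x : k / 2 < sin_sqr x -> Psi x <= m.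
  rewrite sin_sqrE => kx; have : k / 2 < `|sin (pi * x)|.
    by have := normr_ge0 (sin (pi * x)); nra.
  have := qsin (K.+1%:R * x) (K%:R * x).
  rewrite -mulrBl -natrB// subSnn mul1r => qx kx'.
  rewrite /Psi /m; have [kq|kq] := leP (k / 4) (q (K%:R * x)).
    by apply: ler_pM; rewrite ?(ltW (P_gt0 _))// qle// qth1.
  rewrite mulrC; apply: ler_pM; rewrite ?(ltW (P_gt0 _))//.
  by apply: qle; rewrite qth1; lra.
(* Here K x1 = th0, and K.+1 x1 = th0 + th0 / K is within d of th0, so the second factor is at least
   (b0 + b1) / 2 > b1. *)
pose x1 := th0 / K%:R.
have Psi_x1 : m < Psi x1.
  rewrite /Psi /x1 mulrCA divff ?gt_eqF// mulr1 /m mulrC ltr_pM2l; last lra.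
  have -> : K.+1%:R * (th0 / K%:R) = th0 + th0 / K%:R.
    by rewrite -natr1; field; rewrite gt_eqF.
  have : `|P th0 - P (th0 + th0 / K%:R)| <= (b0 - b1) / 2.
    apply: (Pd _ _ 0 0); last by rewrite subrr normr0 ltW.
    rewrite opprD addrA subrr sub0r normrN normrM normfV (gtr0_norm Kgt0).
    apply: le_trans (ler_wpM2l (normr_ge0 _) HK) _.
    rewrite mulrCA ler_piMr ?(ltW d0)// ler_pdivrMr// mul1r; lra.
  by move=> /ler_normlP[_]; rewrite -/b0; lra.
have PsiD1 x : Psi (x + 1) = Psi x by rewrite /Psi !mulrDr !mulr1 !PDn.
have cP n : continuous (fun x => P (n%:R * x)).
  have := buc_affine n%:R 0 0 0 0 0 bucP => /(buc_continuous (y := 0)).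
  by apply: eq_fun_continuous => x; rewrite !(mul0r, addr0).
have cPsi : continuous Psi by exact: fun_continuousM.
pose g x := (`|Psi x / m - 1| + (Psi x / m - 1)) / 2.
have cg : continuous g.
  have c' : continuous (fun x => Psi x / m - 1).
    apply: fun_continuousB; last exact: fun_continuous_cst.
    by apply: fun_continuousM => //; exact: fun_continuous_cst.
  apply: fun_continuousM; last exact: fun_continuous_cst.
  apply: fun_continuousD => // x.
  apply: (@continuous_comp _ _ _ (fun x => Psi x / m - 1) (fun x => `|x|)).
    exact: c'.
  exact: continuous_norm.
have g_gt0 : 0 < mean g.
  apply: (@mean_gt0 _ _ x1) => //.
  - by move=> x; rewrite /g PsiD1.
  - by move=> x; rewrite /g; have [?|?] := ger0P (Psi x / m - 1); lra.
  - have : 1 < Psi x1 / m by rewrite ltr_pdivlMr// mul1r.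
    by rewrite /g => ?; rewrite ger0_norm; lra.
(* With this n the lower bound m^n (n (1 - c) g - c) for the integrand has positive mean. *)
pose n := (Num.truncn (c / ((1 - c) * mean g))).+1.
have ng : c < n%:R * ((1 - c) * mean g).
  by rewrite -ltr_pdivrMr ?mulr_gt0 ?truncnS_gt//; lra.
exists (flatten (nseq n [:: K; K.+1])).
have -> : (fun x => (cutoff k x - c) * \prod_(K <- flatten (nseq n [:: K; K.+1]))
    P (K%:R * x)) = (fun x => (cutoff k x - c) * Psi x ^+ n).
  apply/funext => x; congr (_ * _).
  elim: n {ng} => [|n IHn]; first by rewrite /= big_nil expr0.
  by rewrite /= !big_cons IHn exprS mulrA.
have cPn : continuous (fun x => Psi x ^+ n).
  elim: n {ng} => [|n IHn]; first exact: fun_continuous_cst.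
  by apply: eq_fun_continuous (fun_continuousM cPsi IHn) => x; rewrite exprS.
apply: (@lt_le_trans _ _ (mean (fun x => m ^+ n * (n%:R * (1 - c) * g x - c)))).
  have cc := @fun_continuous_cst R.
  have c1' : continuous (fun x => n%:R * (1 - c) * g x) by exact: fun_continuousM.
  rewrite meanZ; last exact: fun_continuousB.
  rewrite meanB// meanZ// mean_cst mulr_gt0 ?exprn_gt0//.
  by rewrite subr_gt0 -mulrA.
have cc := @fun_continuous_cst R.
apply: le_mean.
- by apply: fun_continuousM => //; apply: fun_continuousB => //; exact: fun_continuousM.
- apply: fun_continuousM => //; apply: fun_continuousB => //.
  exact: (buc_continuous (y := 0) (buc_cutoff k)).
move=> x; have -> : Psi x ^+ n = m ^+ n * (Psi x / m) ^+ n.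
  by rewrite -exprMn mulrC divfK ?gt_eqF.
rewrite [leRHS]mulrCA ler_pM2l ?exprn_gt0// /g.
have t0 : 0 <= Psi x / m by rewrite divr_ge0// ltW.
apply: weighted_power_ge => //; first by rewrite c0.
  by have /andP[] := clamp_itv (2 - 2 * sin_sqr x / k).
rewrite ltr_pdivlMr// mul1r => mP; apply: cutoff_eq1 => //.
by rewrite leNgt; apply/negP => /Psi_le; rewrite leNgt mP.
Qed.

End Weights.

(** * Gapped sequences and finite sets with gaps *)

Section Gaps.
Context {R : realType}.

Lemma mem_gapped N s h k : gapped N s -> h \in s -> k \in s -> (h < k)%N ->
  (N < k - h)%N.
Proof.
move=> /(pairwiseP 0%N) gs hs ks hk.
have ih : (index h s < size s)%N by rewrite index_mem.
have ik : (index k s < size s)%N by rewrite index_mem.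
have hik := gs _ _ ih ik; have hki := gs _ _ ik ih.
rewrite /= !nth_index// in hik hki.
have [/hik|/hki|e] := ltngtP (index h s) (index k s); [lia|lia|].
by have := nth_index 0%N hs; rewrite e nth_index// => ?; lia.
Qed.

Lemma gapped_uniq N s : gapped N s -> uniq s.
Proof. by apply: pairwise_uniq => x /=; lia. Qed.

Lemma gapped_exp_sum N s : gapped N s -> s != [::] ->
  idempotent_gaps N (exp_seq (R := R) s).
Proof.
move=> gs s0; exists [fset h in s]%fset; split.
- by case: s s0 {gs} => [//|h s _]; apply/fset0Pn; exists h; rewrite !inE eqxx.
- by move=> h k; rewrite !inE => hs ks hk _; exact: mem_gapped gs hs ks hk.
- apply/funext => x; apply: perm_big; apply: uniq_perm; rewrite ?fset_uniq//.
    exact: gapped_uniq gs.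
  by move=> h; rewrite !inE.
Qed.

(** The least element l of H above h is consecutive to h, and l <= k. *)
Lemma gaps_larger_lt N (H : {fset nat}) h k : gaps_larger N H ->
  h \in H -> k \in H -> (h < k)%N -> (N < k - h)%N.
Proof.
move=> gH hH kH hk.
have ex : exists l, (l \in H) && (h < l)%N by exists k; rewrite kH.
have [l /andP[lH hl] lmin] := ex_minnP ex.
have lk : (l <= k)%N by apply: lmin; rewrite kH.
have := gH h l hH lH hl; suff : forall j, j \in H -> ~~ (h < j < l)%N.
  by move=> jP /(_ jP); lia.
move=> j jH; apply/negP => /andP[hj jl].
by have := lmin j; rewrite jH hj => /(_ isT); lia.
Qed.

End Gaps.

(** * Concentration *)

Section Concentration.
Context {R : realType}.
Implicit Types (a b c p x : R) (E : set R) (s : seq nat).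

(** E contains a ball around 0 and, by periodicity, one around 1; between them sin^2(pi x) is
    smallest at the ends, being symmetric about 1/2 and increasing up to it. *)
Lemma nbhs0_sin_sqr E : periodic_set E -> open E -> E 0 ->
  exists2 k : R, 0 < k <= 1 & forall x, 0 <= x < 1 -> ~ E x -> k <= sin_sqr x.
Proof.
move=> pE oE E0; have : nbhs (0 : R) E by exact: open_nbhs_nbhs.
move=> /nbhs_ballP[r /= r0 rE].
have {}rE x : `|x| < r -> E x by move=> xr; apply: rE; rewrite /ball/= sub0r normrN.
(* The bound 1/4 keeps d in [0, 1/2], where [cosc] decreases. *)
pose d := Num.min (r / 2) 4^-1.
have d0 : 0 < d by rewrite lt_min; apply/andP; split; lra.
have dr : d < r by rewrite gt_min; apply/orP; left; lra.
have d4 : d <= 4^-1 by rewrite ge_min lexx orbT.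
have pi0 := pi_gt0 R.
have itv x : 0 <= x -> x <= 2^-1 -> 2 * pi * x \in `[0, pi].
  move=> x0 x2; rewrite in_itv/= (_ : 2 * pi * x = pi * (2 * x)); last ring.
  have x20 : 0 <= 2 * x by lra.
  by rewrite (mulr_ge0 (ltW pi0) x20) ler_piMr ?(ltW pi0)//; lra.
have cosc_le x y : 0 <= x -> x <= y -> y <= 2^-1 -> cosc y <= cosc x.
  move=> x0 xy y2; rewrite /cosc leNgt ltr_cos ?itv//; try lra.
  by rewrite -leNgt ler_wpM2l// mulr_ge0// (ltW pi0).
exists (sin_sqr d).
  have : cosc d < cosc 0.
    rewrite /cosc ltr_cos ?itv//; try lra.
    by rewrite mulr0 !mulr_gt0.
  rewrite cosc0 /sin_sqr; have := cos_geN1 (2 * pi * d); rewrite -/(cosc d) => ? ?.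
  by apply/andP; split; lra.
move=> x /andP[x0 x1] Ex.
have dx : d <= x.
  rewrite leNgt; apply/negP => xd; apply: Ex; apply: rE.
  by rewrite ger0_norm//; exact: lt_trans dr.
have dx' : x <= 1 - d.
  rewrite leNgt; apply/negP => xd; apply: Ex.
  rewrite -(subrK 1 x); apply/pE; apply: rE.
  by rewrite ltr0_norm; lra.
suff : cosc x <= cosc d by rewrite /sin_sqr; lra.
have [x2|x2] := leP x 2^-1; first exact: cosc_le (ltW d0) dx x2.
have -> : cosc x = cosc (1 - x).
  have := coscD1 (- x); rewrite addrC => ->.
  by rewrite /cosc mulrN cosN.
by apply: cosc_le; lra.
Qed.

Lemma profile_concentrates p c : 0 < p -> p <> 2 -> c < 1 ->
  concentrates_with_gaps p 0 c.
Proof.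
move=> p0 p2 c1 E pE _ oE E0 N _.
have s0 : 0 < p / 2 by lra.
have s1 : p / 2 != 1 by apply/eqP => ?; apply: p2; lra.
have [k k01 Ek] := nbhs0_sin_sqr pE oE E0.
have k0 : 0 < k by have /andP[] := k01.
(* The constant c may be negative, whereas the peaked product is built for a nonnegative one. *)
pose c' := Num.max c 0.
have c'01 : 0 <= c' < 1 by rewrite le_max lexx orbT gt_max c1 ltr01.
have [q [th0 [q0 q_ge0 qle qlt [qsin qsurj]]]] := profile_peak s0 s1.
have bP : buc (fun x _ => profile (p / 2) x).
  by apply: eq_buc (buc_mean (buc_trinomial_powR 1 s0)) => x y; rewrite mul1r.
have [Ks KsP] := exists_peaked_product bP (profileDn (p / 2))
  (fun x => profile_gt0 x s0) q0 q_ge0 qle qlt qsin qsurj c'01 k01.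
(* Positivity of the mean of (cutoff - c') |f|^p says that the cutoff captures more than the
   fraction c' of the integral of |f|^p. *)
have bw : buc (fun x _ => cutoff k x - c') := bucD (buc_cutoff k) (buc_cst (- c')).
have pw x : cutoff k (x + 1) - c' = cutoff k x - c' by rewrite cutoffD1.
have [s [sn0 gs ms]] := exists_gapped s0 bw pw KsP N.
exists (exp_seq s); split; first exact: gapped_exp_sum gs sn0.
pose g x := `|exp_seq_sqr s x| `^ (p / 2).
have fg x : ComplexField.Normc.normc (exp_seq s x) `^ p = g x.
  by rewrite normc_powR sqr_modulus_exp_seq.
have bg := buc_comp (continuous_norm_powR s0) (buc_exp_seq_sqr (R := R) s).
have cg : continuous g := buc_continuous (y := 0) bg.
have cb : continuous (cutoff k) := buc_continuous (y := 0) (buc_cutoff k).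
have c'g : continuous (fun x => c' * g x).
  by apply: fun_continuousM => //; exact: fun_continuous_cst.
rewrite (circle_integralT cg fg).
have mE := measurable_realfun.open_measurable oE.
apply: le_trans (circle_integral_ge (w := cutoff k) mE cg cb fg _ _);
  last 2 first.
- by move=> x; exact: clamp_itv.
- by move=> x x01 Ex; apply: cutoff_eq0 => //; exact: Ek.
have g0 : 0 <= mean g.
  rewrite -(mean_cst (0 : R)); apply: le_mean => //; first exact: fun_continuous_cst.
  by move=> x; exact: powR_ge0.
rewrite -EFinM lee_fin; apply: (@le_trans _ _ (c' * mean g)).
  by rewrite ler_wpM2r// le_max lexx.
rewrite -meanZ// -subr_ge0 -meanB//; last exact: fun_continuousM.
apply: ltW; move: ms; congr (0 < mean _).
by apply/funext => x; rewrite /g mulrBl.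
Qed.

(** Translation by half a period, 1 / (2 n), changes the sign of the integrand. *)
Lemma mean_cosc (n : int) b : n != 0 -> mean (fun x => cosc (n%:~R * x + b)) = 0.
Proof.
move=> n0; have n0R : n%:~R != 0 :> R by rewrite intr_eq0.
pose g x := cosc (n%:~R * x + b).
have cg : continuous g.
  apply: eq_fun_continuous (buc_continuous (y := 0) (buc_cosc n%:~R 0 b)) => x.
  by rewrite mulr0 addr0.
have pg x : g (x + 1) = g x.
  by rewrite /g mulrDr mulr1 addrAC periodic_int//; exact: coscD1.
have := mean_shift (2^-1 / n%:~R) cg pg.
have -> : (fun x => g (x + 2^-1 / n%:~R)) = (fun x => -1 * g x).
  apply/funext => x; rewrite /g mulN1r -coscDhalf; congr cosc.
  by rewrite mulrDr mulrCA divff// mulr1 addrAC.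
by rewrite meanZ//; rewrite -/g; lra.
Qed.

Lemma mean_cosc_mul (m n : int) b b' : m + n != 0 -> m - n != 0 ->
  mean (fun x => cosc (m%:~R * x + b) * cosc (n%:~R * x + b')) = 0.
Proof.
move=> mn mn'.
have c (k : int) d : continuous (fun x => 2^-1 * cosc (k%:~R * x + d)).
  apply: fun_continuousM; first exact: fun_continuous_cst.
  apply: eq_fun_continuous (buc_continuous (y := 0) (buc_cosc k%:~R 0 d)) => x.
  by rewrite mulr0 addr0.
have c' (k : int) d : continuous (fun x => cosc (k%:~R * x + d)).
  apply: eq_fun_continuous (buc_continuous (y := 0) (buc_cosc k%:~R 0 d)) => x.
  by rewrite mulr0 addr0.
have -> : (fun x => cosc (m%:~R * x + b) * cosc (n%:~R * x + b')) =
  (fun x => 2^-1 * cosc ((m + n)%:~R * x + (b + b')) +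
            2^-1 * cosc ((m - n)%:~R * x + (b - b'))).
  apply/funext => x; set u := m%:~R * x + b; set v := n%:~R * x + b'.
  have -> : (m + n)%:~R * x + (b + b') = u + v by rewrite rmorphD/= /u /v; ring.
  have -> : (m - n)%:~R * x + (b - b') = u - v by rewrite rmorphB/= /u /v; ring.
  rewrite /cosc.
  have -> : 2 * pi * (u + v) = 2 * pi * u + 2 * pi * v by ring.
  have -> : 2 * pi * (u - v) = 2 * pi * u - 2 * pi * v by ring.
  by rewrite cosD cosB; field.
by rewrite meanD// !meanZ// !mean_cosc// mulr0 addr0.
Qed.

(** The first factor is a translate of |D_L|^2. Its frequencies i - j are smaller than L in absolute
    value, while h - k is 0 or larger than L in absolute value, so only the terms with i = j and h =
    k contribute, each of them 1. *)
Lemma mean_exp_seq_sqr_iota_mul L s a : uniq s ->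
  (forall h k, h \in s -> k \in s -> (h < k)%N -> (L < k - h)%N) ->
  mean (fun x => exp_seq_sqr (iota 0 L) (x - a) * exp_seq_sqr s x) =
  L%:R * (size s)%:R.
Proof.
move=> us gs.
have cc (k h : nat) d : continuous (fun x => cosc (k%:R * (x - d) - h%:R * (x - d))).
  apply: eq_fun_continuous (buc_continuous (y := 0)
    (buc_cosc (k%:R - h%:R) 0 (- ((k%:R - h%:R) * d)))) => x.
  by congr cosc; ring.
have cF i j h k : continuous (fun x => cosc (i%:R * (x - a) - j%:R * (x - a)) *
    cosc (h%:R * x - k%:R * x)).
  apply: fun_continuousM => //; have := cc h k 0.
  by apply: eq_fun_continuous => x; rewrite subr0.
have E : (fun x => exp_seq_sqr (iota 0 L) (x - a) * exp_seq_sqr s x) =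
    (fun x => \sum_(h <- s) \sum_(k <- s) \sum_(i <- iota 0 L) \sum_(j <- iota 0 L)
      (cosc (i%:R * (x - a) - j%:R * (x - a)) * cosc (h%:R * x - k%:R * x))).
  apply/funext => x; rewrite /exp_seq_sqr mulr_sumr; apply: eq_bigr => h _.
  rewrite mulr_sumr; apply: eq_bigr => k _.
  by rewrite mulr_suml; apply: eq_bigr => i _; rewrite mulr_suml.
rewrite E mean_sum; last by move=> h; do 3!apply: continuous_sum => ?.
under eq_bigr do (rewrite mean_sum; last by move=> k; do 2!apply: continuous_sum => ?).
under eq_bigr do under eq_bigr do
  (rewrite mean_sum; last by move=> i; apply: continuous_sum => ?).
under eq_bigr do under eq_bigr do under eq_bigr do rewrite mean_sum//.
have term (i j h k : nat) : (i < L)%N -> (j < L)%N -> h \in s -> k \in s ->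
    mean (fun x => cosc (i%:R * (x - a) - j%:R * (x - a)) * cosc (h%:R * x - k%:R * x)) =
    (if (i == j) && (h == k) then 1 else 0).
  move=> iL jL hs ks; case: ifPn => [/andP[/eqP-> /eqP->]|ijhk].
    by under eq_fun do rewrite !subrr cosc0 mulr1; rewrite mean_cst.
  have -> : (fun x => cosc (i%:R * (x - a) - j%:R * (x - a)) *
      cosc (h%:R * x - k%:R * x)) =
    (fun x => cosc ((i%:Z - j%:Z)%:~R * x + - ((i%:R - j%:R) * a)) *
      cosc ((h%:Z - k%:Z)%:~R * x + 0)).
    apply/funext => x; rewrite !rmorphB/= addr0.
    by congr (cosc _ * cosc _); ring.
  have gap : h != k -> (L < h - k)%N || (L < k - h)%N.
    by rewrite neq_ltn => /orP[hk|kh]; [rewrite (gs h k)// orbT|rewrite (gs k h)].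
  by apply: mean_cosc_mul; move: ijhk gap; case: (i =P j); case: (h =P k) => /=; lia.
have -> : L%:R * (size s)%:R = \sum_(h <- s) L%:R :> R.
  by rewrite big_const_seq count_predT iter_addr_0 mulr_natr.
apply: eq_big_seq => h hs.
rewrite (bigD1_seq h)//= [X in _ + X]big1_seq ?addr0; last first.
  move=> k /andP[kh ks]; rewrite big1_seq// => i; rewrite mem_iota => /andP[_ iL].
  rewrite big1_seq// => j; rewrite mem_iota => /andP[_ jL].
  by rewrite term// (eq_sym h) (negbTE kh) andbF.
have -> : L%:R = \sum_(i <- iota 0 L) 1 :> R.
  by rewrite big_const_seq count_predT iter_addr_0 size_iota.
apply: eq_big_seq => i; rewrite mem_iota => /andP[_ iL].
rewrite (bigD1_seq i) ?iota_uniq ?mem_iota//= term// !eqxx/=.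
rewrite [X in _ + X]big1_seq ?addr0//.
move=> j /andP[ji]; rewrite mem_iota => /andP[_ jL].
by rewrite term// (eq_sym i) (negbTE ji).
Qed.

End Concentration.

(** * Failure of concentration for p = 2 *)

Section NoConcentration.
Context {R : realType}.

Lemma exp_seq_sqrN s (x : R) : exp_seq_sqr s (- x) = exp_seq_sqr s x.
Proof.
apply: eq_bigr => h _; apply: eq_bigr => k _.
have -> : h%:R * - x - k%:R * - x = - (h%:R * x - k%:R * x) by ring.
by rewrite /cosc mulrN cosN.
Qed.

Lemma exp_seq_sqr0 L : exp_seq_sqr (iota 0 L) (0 : R) = L%:R ^+ 2.
Proof.
rewrite /exp_seq_sqr; under eq_bigr do under eq_bigr do rewrite !mulr0 subrr cosc0.
rewrite big_const_seq count_predT iter_addr_0 size_iota.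
by rewrite big_const_seq count_predT iter_addr_0 size_iota -mulrnA -natrX -mulnn.
Qed.

Lemma not_concentrates2 (a c : R) : 0 < c -> ~ concentrates_with_gaps 2 a c.
Proof.
move=> c0 conc.
(* This gives 4 / L < c, contradicting the bound 4 / L on the share of the mass carried by E. *)
pose L := (Num.truncn (4 / c)).+1.
have cL : 4 / c < L%:R := truncnS_gt _.
have L0 : 0 < L%:R :> R by rewrite ltr0n.
pose d (x : R) := exp_seq_sqr (iota 0 L) x.
have cd (b : R) : continuous (fun x => d (x + b)).
  have := buc_affine 1 0 b 0 0 0 (buc_exp_seq_sqr (R := R) (iota 0 L)).
  move/(buc_continuous (y := 0)); apply: eq_fun_continuous => x.
  by rewrite mul1r mul0r addr0.
have d_ge0 x : 0 <= d x := exp_seq_sqr_ge0 _ _.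
(* The set where the translate of |D_L|^2 to a or to -a exceeds half its peak L^2; it is symmetric
   because |D_L|^2 is even. *)
pose E : set R :=
  [set x | L%:R ^+ 2 / 2 < d (x + - a)] `|` [set x | L%:R ^+ 2 / 2 < d (x + a)].
have oE : open E.
  have o b : open [set x | L%:R ^+ 2 / 2 < d (x + b)].
    apply: (@open_comp _ _ (fun x => d (x + b)) [set y | L%:R ^+ 2 / 2 < y]).
      by move=> x _; exact: cd.
    exact: open_gt.
  exact: openU.
have pE : periodic_set E.
  by move=> x; rewrite /E/= /d ![x + 1 + _]addrAC !exp_seq_sqrD1.
have sE : symmetric_set E.
  move=> x; rewrite /E/= /d -opprD exp_seq_sqrN (_ : - x + a = - (x - a)).
    by rewrite exp_seq_sqrN => -[]; [right|left].
  by rewrite opprB addrC.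
have Ea : E a.
  left => /=; rewrite subrr /d exp_seq_sqr0.
  by rewrite ltr_pdivrMr// ltr_pMr ?exprn_gt0// ltr1n.
(* Gaps larger than L exceed every frequency of |D_L|^2. *)
have [_ [[H [H0 gH ->]]]] := conc E pE sE oE Ea L isT.
set s : seq nat := enum_fset H.
pose g x : R := exp_seq_sqr s x.
have fg x : ComplexField.Normc.normc (exp_sum (R := R) H x) `^ 2 = g x.
  rewrite normc_powR sqr_modulus_exp_seq divff ?pnatr_eq0// powRr1//.
  by rewrite ger0_norm// exp_seq_sqr_ge0.
have cg : continuous g := buc_continuous (y := 0) (buc_exp_seq_sqr s).
have us : uniq s := fset_uniq H.
have gs h k : h \in s -> k \in s -> (h < k)%N -> (L < k - h)%N.
  exact: gaps_larger_lt gH.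
(* The factor 2 / L^2 is the inverse of the threshold defining E, so w >= 1 on E. *)
pose w x := 2 / L%:R ^+ 2 * (d (x + - a) + d (x + a)).
have cw : continuous w.
  by apply: fun_continuousM; [exact: fun_continuous_cst|exact: fun_continuousD].
have L20 : 0 < 2 / L%:R ^+ 2 :> R by rewrite divr_gt0 ?exprn_gt0.
(* Parseval's identity, as the case of the trivial kernel |D_1|^2 = 1. *)
have mg : mean g = (size s)%:R.
  have := @mean_exp_seq_sqr_iota_mul R 1 s 0 us; rewrite mul1r => <-.
    congr mean; apply/funext => x; rewrite subr0 {1}/exp_seq_sqr !big_seq1.
    by rewrite subrr cosc0 mul1r.
  by move=> h k hs ks hk; have := gs h k hs ks hk; lia.
have dg (b : R) : mean (fun x => d (x + b) * g x) = L%:R * (size s)%:R.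
  by rewrite -(opprK b); exact: mean_exp_seq_sqr_iota_mul.
have mwg : mean (fun x => w x * g x) = 4 / L%:R * (size s)%:R.
  have -> : (fun x => w x * g x) = (fun x => 2 / L%:R ^+ 2 *
      (d (x + - a) * g x + d (x + a) * g x)).
    apply/funext => x; rewrite /w; move: (2 / _) => u; ring.
  have cdg b : continuous (fun x => d (x + b) * g x) by exact: fun_continuousM.
  rewrite meanZ; last exact: fun_continuousD.
  by rewrite meanD// !dg; field; rewrite gt_eqF.
rewrite (circle_integralT cg fg) => ineq.
have wE x : E x -> 1 <= w x.
  have L2 : 2 / L%:R ^+ 2 * (L%:R ^+ 2 / 2) = 1 :> R by field; rewrite gt_eqF.
  move=> Ex; rewrite /w -[leLHS]L2 ler_pM2l//.
  have := d_ge0 (x - a); have := d_ge0 (x + a).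
  by case: Ex => /= ? ? ?; lra.
have w0 x : 0 <= w x by rewrite /w mulr_ge0 ?addr_ge0// ltW.
have := le_trans ineq
  (circle_integral_le (measurable_realfun.open_measurable oE) cg cw fg w0 wE).
rewrite -EFinM lee_fin mwg mg ler_pM2r; last first.
  by rewrite ltr0n lt0n -/(size s) cardfs_eq0.
by rewrite leNgt ltr_pdivrMr// mulrC -ltr_pdivrMr// cL.
Qed.

End NoConcentration.

Theorem proposition9 (R : realType) :
  (forall p : R, 0 < p -> p <> 2 ->
     forall c : R, c < 1 -> concentrates_with_gaps p 0 c) /\
  (forall a : R, ~ exists c : R, 0 < c /\ concentrates_with_gaps 2 a c).
Proof.
split=> [p p0 p2 c c1|a [c [c0]]]; first exact: profile_concentrates.
exact: not_concentrates2.
Qed.
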